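(* Let $e_*\in\mathbb{N}$ be an index such that $V_{e_*}^X=V_*^X$ for every real $X$, where $V_*^X$ is the uniformly $\Pi^{1,X}_1$ set defined in the context. If $A$ is a real with $$\mathcal{O}\leq_{\mathrm T}A<_{\mathrm T}\mathcal{O}^{\mathcal{O}},$$ then there is no real $B$ such that $A\equiv_{\mathrm T}\mathrm{HJ}_{e_*}(B)$. Consequently, the following statement (the pseudo-hyperjump inversion conjecture) is false: for every $e\in\mathbb{N}$ and every real $A$ with $\mathcal{O}\leq_{\mathrm T}A$ there is a real $B$ such that $$A\equiv_{\mathrm T}\mathrm{HJ}_e(B)\equiv_{\mathrm T}B\oplus\mathcal{O}.$$ In fact, this statement remains false if its hypothesis $\mathcal{O}\leq_{\mathrm T}A$ is strengthened to $\mathcal{O}<_{\mathrm T}A$.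
   Context: Reals are subsets of $\mathbb{N}$, identified with elements of $2^{\mathbb{N}}$. $\leq_{\mathrm T}$ is Turing reducibility, with $<_{\mathrm T}$ and $\equiv_{\mathrm T}$ the associated strict and equivalence relations; $X\oplus Y$ is the usual effective join; $X'$ is the Turing jump of $X$. The ordinal $\omega_1^X$ is the least ordinal which is not the order type of an $X$-recursive well-ordering, and $\omega_1^{\mathrm{CK}}=\omega_1^{\emptyset}$. For a real $X$, $\mathcal{O}^X$ is the relativized Kleene $\mathcal{O}$ (the hyperjump of $X$), which is $\Pi^{1,X}_1$-complete uniformly in $X$ (its Turing degree is that of the set of indices of $X$-recursive well-orderings); $\mathcal{O}=\mathcal{O}^{\emptyset}$, and $\mathcal{O}^{\mathcal{O}}$ is the hyperjump of $\mathcal{O}$. All analytical pointclasses are lightface, with oracle parameters indicated. Let $(V_e^X)_{e\in\mathbb{N}}$ be a standard effective enumeration, uniform in $X$, of the $\Pi^{1,X}_1$ subsets of $\mathbb{N}$; in particular, for every $\Pi^1_1$ predicate $Q(n,X)$ there is an $e$ such that $V_e^X=\{n:Q(n,X)\}$ for every real $X$. The pseudo-hyperjump operators are $\mathrm{HJ}_e(X)=X\oplus V_e^X$. Define, uniformly in $X$, the set $V_*^X\subseteq\mathbb{N}$ by: $2n\in V_*^X\iff n\in X'$; and $2n+1\in V_*^X\iff(\omega_1^X>\omega_1^{\mathrm{CK}}$ and $n\in\mathcal{O}^X)$. The predicate $\omega_1^X>\omega_1^{\mathrm{CK}}$ is a $\Pi^1_1$ predicate of $X$, so $V_*^X$ is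 uniformly $\Pi^{1,X}_1$ and an index $e_*$ with $V_{e_*}^X=V_*^X$ for every real $X$ exists; fix one. *)

(* Defs.v *)
From mathcomp Require Import all_boot.
From mathcomp Require Import boolp classical_sets functions wochoice.
From Stdlib Require Cantor.

Set Implicit Arguments.
Unset Strict Implicit.
Unset Printing Implicit Defensive.

Local Open Scope classical_set_scope.
Local Open Scope nat_scope.

Notation real := (set nat).

Definition npair (x y : nat) : nat := Cantor.to_nat (x, y).
Notation "⟨ x , y ⟩" := (npair x y) (at level 0, x at level 99, y at level 99).

(* [eval g e x y]: the partial function {e}^g, recursive in the total oracle
   g : nat -> nat, converges at x with value y.  Every natural number is an
   index: the first component of e, seen as a pair, selects a schema (basic
   functions, oracle call, pairing, composition, primitive recursion,
   minimization); an index whose first component is at least 9 denotes the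
   nowhere defined function. *)
Inductive eval (g : nat -> nat) : nat -> nat -> nat -> Prop :=
| eval_zero c x : eval g ⟨0, c⟩ x 0
| eval_succ c x : eval g ⟨1, c⟩ x x.+1
| eval_fst c x y : eval g ⟨2, c⟩ ⟨x, y⟩ x
| eval_snd c x y : eval g ⟨3, c⟩ ⟨x, y⟩ y
| eval_oracle c x : eval g ⟨4, c⟩ x (g x)
| eval_pair a b x u v :
    eval g a x u -> eval g b x v -> eval g ⟨5, ⟨a, b⟩⟩ x ⟨u, v⟩
| eval_comp a b x y z :
    eval g b x y -> eval g a y z -> eval g ⟨6, ⟨a, b⟩⟩ x z
| eval_prec0 a b x y :
    eval g a x y -> eval g ⟨7, ⟨a, b⟩⟩ ⟨x, 0⟩ y
| eval_precS a b x n y z :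
    eval g ⟨7, ⟨a, b⟩⟩ ⟨x, n⟩ y -> eval g b ⟨x, ⟨n, y⟩⟩ z ->
    eval g ⟨7, ⟨a, b⟩⟩ ⟨x, n.+1⟩ z
| eval_mu a x n (w : nat -> nat) :
    (forall m, m < n -> eval g a ⟨x, m⟩ (w m).+1) ->
    eval g a ⟨x, n⟩ 0 -> eval g ⟨8, a⟩ x n.

Definition char (X : real) (n : nat) : nat := `[< X n >].

Definition turing_le (X Y : real) : Prop :=
  exists e, forall n, eval (char Y) e n (char X n).
Definition turing_lt (X Y : real) : Prop := turing_le X Y /\ ~ turing_le Y X.
Definition turing_eq (X Y : real) : Prop := turing_le X Y /\ turing_le Y X.

Notation "X <=T Y" := (turing_le X Y) (at level 70, no associativity).
Notation "X <T Y" := (turing_lt X Y) (at level 70, no associativity).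
Notation "X =T Y" := (turing_eq X Y) (at level 70, no associativity).

Definition tjoin (X Y : real) : real :=
  [set n | if odd n then Y n./2 else X n./2].

Definition jump (X : real) : real := [set n | exists y, eval (char X) n n y].

(* Well-orderings of subsets of nat are given by their reflexive relation, so
   that [rel_field R] is the underlying set. *)
Definition rel_field (R : rel nat) : real := [set x | R x x].

Definition wellorder (R : rel nat) : Prop :=
  (forall x y, R x y -> R x x /\ R y y) /\ wo_chain R [pred x | R x x].

Definition order_iso (R S : rel nat) : Prop :=
  exists2 f : nat -> nat, set_bij (rel_field R) (rel_field S) f
    & forall x y, R x x -> R y y -> R x y = S (f x) (f y).

Definition init_segment (R : rel nat) (v : nat) : rel nat :=
  [rel x y | [&& R x y, R y v & y != v]].

Definition otype_lt (R S : rel nat) : Prop :=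
  exists2 v, S v v & order_iso R (init_segment S v).

Definition graph (R : rel nat) : real :=
  [set n | R (Cantor.of_nat n).1 (Cantor.of_nat n).2].

Definition recursive_otype (X : real) (R : rel nat) : Prop :=
  exists S, [/\ wellorder S, graph S <=T X & order_iso R S].

(* The order type of R is omega_1^X.  This ordinal is countable, so it has a
   representative among the well-orderings of subsets of nat. *)
Definition is_omega1 (X : real) (R : rel nat) : Prop :=
  [/\ wellorder R, ~ recursive_otype X R &
      forall S, wellorder S -> otype_lt S R -> recursive_otype X S].

(* omega_1^X > omega_1^CK *)
Definition omega1_gt_CK (X : real) : Prop :=
  exists R S, [/\ is_omega1 set0 R, is_omega1 X S & otype_lt R S].

(* Kleene's O and the relation a <_O b on it, relative to the oracle g. *)
Inductive inO (g : nat -> nat) : nat -> Prop :=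
| inO_zero : inO g 1
| inO_succ a : inO g a -> inO g (2 ^ a)
| inO_lim e (f : nat -> nat) :
    (forall n, eval g e n (f n)) -> (forall n, inO g (f n)) ->
    (forall n, ltO g (f n) (f n.+1)) -> inO g (3 * 5 ^ e)
with ltO (g : nat -> nat) : nat -> nat -> Prop :=
| ltO_succ a : inO g a -> ltO g a (2 ^ a)
| ltO_lim e (f : nat -> nat) n :
    (forall n, eval g e n (f n)) -> (forall n, inO g (f n)) ->
    (forall n, ltO g (f n) (f n.+1)) -> ltO g (f n) (3 * 5 ^ e)
| ltO_trans a b c : ltO g a b -> ltO g b c -> ltO g a c.

Definition KleeneO (X : real) : real := [set a | inO (char X) a].

Definition oracle_join (X : real) (f : nat -> nat) (n : nat) : nat :=
  if odd n then f n./2 else char X n./2.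

(* The enumeration of the Pi^1_1 sets in X given by Kleene's normal form. The
   universal quantifier ranges over functions: over elements of 2^nat it would
   only yield the r.e. sets in X, by compactness. *)
Definition Pi11 (e : nat) (X : real) : real :=
  [set n | forall f : nat -> nat, exists y, eval (oracle_join X f) e n y].

Definition HJ (e : nat) (X : real) : real := tjoin X (Pi11 e X).

Definition Vstar (X : real) : real :=
  [set m | if odd m then omega1_gt_CK X /\ KleeneO X m./2 else jump X m./2].

(* Main.v *)
Require Import Defs.
From mathcomp Require Import all_boot.
From mathcomp Require Import boolp classical_sets.
From mathcomp Require Import wochoice zify.
From Stdlib Require Cantor.

(* Write O for Kleene's O.  If omega_1^B > omega_1^CK, then O is Delta^1_1 in B:
   a Pi^1_1 fact about a number says that a recursive tree is well founded, and
   this holds iff the tree maps, strictly decreasingly, into a B-recursive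
   well-ordering that is longer than every recursive one.  Hence O^O is
   Pi^1_1 in B, and O^O <= O^B <= HJ_{e_star}(B).  If omega_1^B = omega_1^CK,
   then HJ_{e_star}(B) is equivalent to B', which cannot compute O: otherwise
   the set of indices of recursive well-orderings would be arithmetical in B, and
   a B-recursive tree would be well founded iff it maps into a recursive
   well-ordering with such an index, so that every Pi^1_1(B) set would be
   Sigma^1_1(B).  Thus no A with O <= A < O^O is inverted by e_star, and A = O'
   lies strictly between O and O^O. *)

Set Implicit Arguments.
Unset Strict Implicit.
Unset Printing Implicit Defensive.

Local Open Scope nat_scope.

(** The contradiction in the second case is diagonal: the diagonal of a universal Pi^1_1 predicate
    is not Sigma^1_1. Ordinals are never computed with. Well-foundedness of a tree is certified by a
    strictly descending map into a known well-ordering, and the existence of such a map is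
    Sigma^1_1.

    Two facts about O carry the reductions: it is itself uniformly Pi^1_1, and every uniformly
    Pi^1_1 predicate reduces to it by a map that does not depend on the oracle. A reduction to a
    hyperjump is therefore obtained by writing down a Pi^1_1 definition. Predicates take arbitrary
    functions as oracles, so that a real such as a jump, or O, can be quantified over as a function
    Z singled out by a definition of low enough complexity. *)

(** * Pairing and computable functionals *)

Definition pr1 (n : nat) : nat := (Cantor.of_nat n).1.
Definition pr2 (n : nat) : nat := (Cantor.of_nat n).2.

Lemma npairK1 x y : pr1 ⟨x, y⟩ = x.
Proof. by rewrite /pr1 /npair Cantor.cancel_of_to. Qed.

Lemma npairK2 x y : pr2 ⟨x, y⟩ = y.
Proof. by rewrite /pr2 /npair Cantor.cancel_of_to. Qed.

Definition npairK := (npairK1, npairK2).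

Lemma prK n : ⟨pr1 n, pr2 n⟩ = n.
Proof. by rewrite /pr1 /pr2 /npair -surjective_pairing Cantor.cancel_to_of. Qed.

Lemma npair_inj x y x' y' : ⟨x, y⟩ = ⟨x', y'⟩ -> x = x' /\ y = y'.
Proof.
by move=> E; rewrite -(npairK1 x y) -{2}(npairK2 x y) E !npairK.
Qed.

Lemma npair_ge x y : x + y <= ⟨x, y⟩.
Proof. by apply/leP; rewrite addnC; exact: Cantor.to_nat_non_decreasing. Qed.

Lemma pr1_le n : pr1 n <= n.
Proof. by rewrite -{2}(prK n); have := npair_ge (pr1 n) (pr2 n); lia. Qed.

Section Computable.
(* The oracles range over a class so that the same closure properties give both
   uniform computability and computability relative to a single oracle. *)
Variable K : (nat -> nat) -> Prop.
Implicit Types F G N : (nat -> nat) -> nat -> nat.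

Definition computable F : Prop :=
  exists e, forall g, K g -> forall x, eval g e x (F g x).

Lemma computable_ext F G :
  (forall g x, K g -> F g x = G g x) -> computable F -> computable G.
Proof. by move=> E [e He]; exists e => g Kg x; rewrite -E //; apply: He. Qed.

Lemma computable_comp F G :
  computable F -> computable G -> computable (fun g x => F g (G g x)).
Proof.
move=> [a Ha] [b Hb]; exists ⟨6, ⟨a, b⟩⟩ => g Kg x.
exact: eval_comp (Hb _ Kg _) (Ha _ Kg _).
Qed.

Lemma computable_id : computable (fun _ x => x).
Proof.
(* No schema is the identity, but every number is a pair, so pairing the two projections gives
   it. *)
exists ⟨5, ⟨⟨2, 0⟩, ⟨3, 0⟩⟩⟩ => g _ x; rewrite -{2}(prK x).
by apply: eval_pair; rewrite -{1}(prK x); constructor.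
Qed.

Lemma computable_const c : computable (fun _ _ => c).
Proof.
elim: c => [|c [e He]]; first by exists ⟨0, 0⟩ => g _ x; constructor.
exists ⟨6, ⟨⟨1, 0⟩, e⟩⟩ => g Kg x.
by apply: eval_comp (He _ Kg _) _; constructor.
Qed.

Lemma computable_pr1 F : computable F -> computable (fun g x => pr1 (F g x)).
Proof.
apply: (@computable_comp (fun _ => pr1)); exists ⟨2, 0⟩ => g _ x.
by rewrite -{1}(prK x); constructor.
Qed.

Lemma computable_pr2 F : computable F -> computable (fun g x => pr2 (F g x)).
Proof.
apply: (@computable_comp (fun _ => pr2)); exists ⟨3, 0⟩ => g _ x.
by rewrite -{1}(prK x); constructor.
Qed.

Lemma computable_succ F : computable F -> computable (fun g x => (F g x).+1).
Proof.
by apply: (@computable_comp (fun _ => succn)); exists ⟨1, 0⟩ => g _ x; constructor.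
Qed.

Lemma computable_oracle F : computable F -> computable (fun g x => g (F g x)).
Proof.
by apply: (@computable_comp (fun g => g)); exists ⟨4, 0⟩ => g _ x; constructor.
Qed.

Lemma computable_pair F G :
  computable F -> computable G -> computable (fun g x => ⟨F g x, G g x⟩).
Proof.
move=> [a Ha] [b Hb]; exists ⟨5, ⟨a, b⟩⟩ => g Kg x.
exact: eval_pair (Ha _ Kg _) (Hb _ Kg _).
Qed.

Lemma computable_comp2 (H : (nat -> nat) -> nat -> nat -> nat) F G :
  computable (fun g z => H g (pr1 z) (pr2 z)) -> computable F -> computable G ->
  computable (fun g x => H g (F g x) (G g x)).
Proof.
move=> cH cF cG.
apply: computable_ext (computable_comp cH (computable_pair cF cG)) => g x _ /=.
by rewrite !npairK.
Qed.

Lemma computable_rec F N (H : (nat -> nat) -> nat -> nat -> nat -> nat) :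
  computable F -> computable N ->
  computable (fun g z => H g (pr1 z) (pr1 (pr2 z)) (pr2 (pr2 z))) ->
  computable (fun g x => nat_rec (fun _ => nat) (F g x) (H g x) (N g x)).
Proof.
move=> [a Ha] cN [b Hb].
have cR : computable (fun g z =>
    nat_rec (fun _ => nat) (F g (pr1 z)) (H g (pr1 z)) (pr2 z)).
  exists ⟨7, ⟨a, b⟩⟩ => g Kg z; rewrite -{1}(prK z); move: (pr1 z) (pr2 z) => x.
  elim=> [|n IH] /=; first by apply: eval_prec0; apply: Ha.
  apply: eval_precS IH _; set y := nat_rec _ _ _ _.
  by have := Hb _ Kg ⟨x, ⟨n, y⟩⟩; rewrite !npairK.
apply: computable_ext (computable_comp cR (computable_pair computable_id cN)).
by move=> g x _ /=; rewrite !npairK.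
Qed.

End Computable.

Ltac comp_step :=
  match goal with
  | H : computable _ _ |- _ => exact H
  | |- computable _ (fun g x => ?c) => exact: computable_const
  | |- computable _ (fun g x => x) => exact: computable_id
  | |- computable _ (fun g x => pr1 _) => apply: computable_pr1
  | |- computable _ (fun g x => pr2 _) => apply: computable_pr2
  | |- computable _ (fun g x => _.+1) => apply: computable_succ
  | |- computable _ (fun g x => npair _ _) => apply: computable_pair
  end.
Ltac comp := repeat comp_step.

(** * Arithmetic and bounded quantifiers *)

Section Arithmetic.
Variable K : (nat -> nat) -> Prop.
Implicit Types F G N : (nat -> nat) -> nat -> nat.
Local Notation computable := (computable K).

Lemma computable_pred F : computable F -> computable (fun g x => (F g x).-1).
Proof.
move=> cF.
apply: (@computable_ext _ (fun g x => nat_rec (fun _ => nat) 0 (fun n _ =>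
  n) (F g x))).
  by move=> g x _; case: (F g x).
by apply: (@computable_rec K (fun _ _ => 0) F (fun _ _ n _ => n)); comp.
Qed.

Lemma computable_add F G :
  computable F -> computable G -> computable (fun g x => F g x + G g x).
Proof.
move=> cF cG.
apply: (@computable_ext _ (fun g x => nat_rec (fun _ =>
  nat) (F g x) (fun _ y => y.+1) (G g x))).
  by move=> g x _; elim: (G g x) => [|n /= ->]; rewrite ?addn0 ?addnS.
by apply: (@computable_rec K F G (fun _ _ _ y => y.+1)); comp.
Qed.

Lemma computable_sub F G :
  computable F -> computable G -> computable (fun g x => F g x - G g x).
Proof.
move=> cF cG.
apply: (@computable_ext _ (fun g x => nat_rec (fun _ =>
  nat) (F g x) (fun _ y => y.-1) (G g x))).
  by move=> g x _; elim: (G g x) => [|n /= ->]; rewrite ?subn0 ?subnS.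
apply: (@computable_rec K F G (fun _ _ _ y => y.-1)); comp.
by apply: computable_pred; comp.
Qed.

Lemma computable_mul F G :
  computable F -> computable G -> computable (fun g x => F g x * G g x).
Proof.
move=> cF cG.
apply: (@computable_ext _ (fun g x => nat_rec (fun _ => nat) 0 (fun _ y =>
  y + F g x) (G g x))).
  by move=> g x _; elim: (G g x) => [|n /= ->]; rewrite ?muln0 ?mulnS 1?addnC.
apply: (@computable_rec K (fun _ _ => 0) G (fun g x _ y => y + F g x)); comp.
by apply: computable_add; comp; apply: computable_comp; comp.
Qed.

Lemma computable_exp F G :
  computable F -> computable G -> computable (fun g x => F g x ^ G g x).
Proof.
move=> cF cG.
apply: (@computable_ext _ (fun g x => nat_rec (fun _ => nat) 1 (fun _ y =>
  y * F g x) (G g x))).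
  by move=> g x _; elim: (G g x) => [|n /= ->]; rewrite ?expnS 1?mulnC.
apply: (@computable_rec K (fun _ _ => 1) G (fun g x _ y => y * F g x)); comp.
by apply: computable_mul; comp; apply: computable_comp; comp.
Qed.

Definition computableb (b : (nat -> nat) -> nat -> bool) : Prop :=
  computable (fun g x => (b g x : nat)).

Lemma computableb_comp b F :
  computableb b -> computable F -> computableb (fun g x => b g (F g x)).
Proof. exact: computable_comp. Qed.

Lemma computableb_leq F G :
  computable F -> computable G -> computableb (fun g x => F g x <= G g x).
Proof.
move=> cF cG.
apply: (@computable_ext _ (fun g x => 1 - (F g x - G g x))) => [g x _|];
  first by lia.
by apply: computable_sub; comp; apply: computable_sub.
Qed.

Lemma computableb_and b c : computableb b -> computableb c ->
  computableb (fun g x => b g x && c g x).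
Proof.
move=> cb cc; apply: (@computable_ext _ (fun g x => b g x * c g x)).
  by move=> g x _; case: (b g x); case: (c g x).
exact: computable_mul.
Qed.

Lemma computableb_not b : computableb b -> computableb (fun g x => ~~ b g x).
Proof.
move=> cb; apply: (@computable_ext _ (fun g x => 1 - b g x)).
  by move=> g x _; case: (b g x).
by apply: computable_sub; comp.
Qed.

Lemma computableb_or b c : computableb b -> computableb c ->
  computableb (fun g x => b g x || c g x).
Proof.
move=> cb cc.
apply: (@computable_ext _ (fun g x => ~~ (~~ b g x && ~~ c g x))).
  by move=> g x _; case: (b g x); case: (c g x).
by apply/computableb_not/computableb_and; apply: computableb_not.
Qed.

Lemma computableb_eqn F G :
  computable F -> computable G -> computableb (fun g x => F g x == G g x).
Proof.
move=> cF cG.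
apply: (@computable_ext _ (fun g x => (F g x <= G g x) && (G g x <= F g x))).
  by move=> g x _; rewrite eqn_leq.
by apply: computableb_and; apply: computableb_leq.
Qed.

Lemma computable_if b F G : computableb b -> computable F -> computable G ->
  computable (fun g x => if b g x then F g x else G g x).
Proof.
move=> cb cF cG.
apply: (@computable_ext _ (fun g x => b g x * F g x + ~~ b g x * G g x)).
  by move=> g x _; case: (b g x); rewrite ?mul1n ?mul0n ?addn0.
apply: computable_add; apply: computable_mul => //.
exact: computableb_not.
Qed.

Lemma computable_iter F N (H : (nat -> nat) -> nat -> nat -> nat) :
  computable F -> computable N ->
  computable (fun g z => H g (pr1 z) (pr2 z)) ->
  computable (fun g x => iter (N g x) (H g x) (F g x)).
Proof.
move=> cF cN cH; apply: (@computable_ext _ (fun g x =>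
   nat_rec (fun _ => nat) (F g x) (fun _ y => H g x y) (N g x))).
  by move=> g x _; elim: (N g x) => [|n /= ->].
apply: (@computable_rec K F N (fun g x _ y => H g x y)) => //.
by apply: (computable_comp2 (H := H)); comp.
Qed.

Lemma computable_odd F : computable F -> computableb (fun g x => odd (F g x)).
Proof.
move=> cF.
apply: (@computable_ext _ (fun g x => iter (F g x) (fun b => 1 - b) 0)).
  by move=> g x _; elim: (F g x) => [|n /= ->] //=; case: odd.
apply: (@computable_iter (fun _ _ => 0) F (fun _ _ b => 1 - b)); comp.
by apply: computable_sub; comp.
Qed.

Lemma computable_half F : computable F -> computable (fun g x => (F g x)./2).
Proof.
move=> cF.
apply: (@computable_ext _ (fun g x =>
   nat_rec (fun _ => nat) 0 (fun n y => y + odd n) (F g x))).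
  by move=> g x _; elim: (F g x) => [|n /= ->] //; rewrite uphalf_half addnC.
apply: (@computable_rec K (fun _ _ => 0) F (fun _ _ n y => y + odd n)); comp.
by apply: computable_add; comp; apply: computable_odd; comp.
Qed.

Lemma computable_double F : computable F -> computable (fun g x => (F g x).*2).
Proof.
move=> cF; apply: (@computable_ext _ (fun g x => F g x + F g x)).
  by move=> g x _; rewrite addnn.
exact: computable_add.
Qed.

Lemma computableb_all b N :
  computable N -> computableb (fun g z => b g (pr1 z) (pr2 z)) ->
  computableb (fun g x => all (b g x) (iota 0 (N g x))).
Proof.
move=> cN cb; apply: (@computable_ext _ (fun g x =>
   nat_rec (fun _ => nat) 1 (fun n y => y * b g x n) (N g x))).
  move=> g x _; elim: (N g x) => [//|n IH].
  rewrite -[in RHS]addn1 iotaD all_cat /= IH andbT add0n.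
  by case: all; case: (b g x n).
apply: (@computable_rec K (fun _ _ => 1) N (fun g x n y => y * b g x n)); comp.
apply: computable_mul; comp.
by apply: (computable_comp2 (H := fun g x n => b g x n : nat)); comp.
Qed.

Lemma computableb_has b N :
  computable N -> computableb (fun g z => b g (pr1 z) (pr2 z)) ->
  computableb (fun g x => has (b g x) (iota 0 (N g x))).
Proof.
move=> cN cb; apply: (@computable_ext _ (fun g x =>
    ~~ all (fun n => ~~ b g x n) (iota 0 (N g x)))).
  by move=> g x _; rewrite -[in RHS](negbK (has _ _)) -all_predC.
apply/computableb_not/(@computableb_all (fun g x n => ~~ b g x n)) => //.
exact: computableb_not.
Qed.

End Arithmetic.

(** Rebinding [comp_step] also strengthens [comp], which calls it by name. *)
Ltac comp_step ::=
  match goal with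
  | H : computable _ _ |- _ => exact H
  | H : computableb _ _ |- _ => exact H
  | |- computableb ?K (fun _ _ => ?c) => exact (computable_const K (nat_of_bool c))
  | |- computableb _ (fun g x => leq _ _) => apply: computableb_leq
  | |- computableb _ (fun g x => eq_op _ _) => apply: computableb_eqn
  | |- computableb _ (fun g x => andb _ _) => apply: computableb_and
  | |- computableb _ (fun g x => orb _ _) => apply: computableb_or
  | |- computableb _ (fun g x => negb _) => apply: computableb_not
  | |- computableb _ (fun g x => odd _) => apply: computable_odd
  | |- computableb _ (fun g x => all _ _) => apply: computableb_all
  | |- computableb _ (fun g x => has _ _) => apply: computableb_has
  | |- computable ?K (fun _ _ => ?c) => exact (computable_const K c)
  | |- computable _ (fun g x => x) => exact: computable_id
  | |- computable _ (fun g x => pr1 _) => apply: computable_pr1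
  | |- computable _ (fun g x => pr2 _) => apply: computable_pr2
  | |- computable _ (fun g x => _.+1) => apply: computable_succ
  | |- computable _ (fun g x => _.-1) => apply: computable_pred
  | |- computable _ (fun g x => npair _ _) => apply: computable_pair
  | |- computable _ (fun g x => addn _ _) => apply: computable_add
  | |- computable _ (fun g x => subn _ _) => apply: computable_sub
  | |- computable _ (fun g x => muln _ _) => apply: computable_mul
  | |- computable _ (fun g x => expn _ _) => apply: computable_exp
  | |- computable _ (fun g x => half _) => apply: computable_half
  | |- computable _ (fun g x => double _) => apply: computable_double
  | |- computable _ (fun g x => iter _ _ _) => apply: computable_iter
  | |- computable _ (fun g x => if _ then _ else _) => apply: computable_if
  | |- computable ?K (fun g x => nat_of_bool (@?b g x)) => change (computableb K b)
  | |- computable _ (fun g x => g _) => apply: computable_oracle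
  end.

(** * A stack machine evaluating indices relative to a partial oracle *)

(* The oracle q is partial: q k = 0 means that k is not answered, and
   q k = v.+1 that the answer is v. *)
Definition Ev (e x k : nat) : nat := ⟨0, ⟨⟨e, x⟩, k⟩⟩.
Definition Rt (v k : nat) : nat := ⟨1, ⟨v, k⟩⟩.
Definition Stuck : nat := ⟨2, 0⟩.
(** The successor keeps 0 free for the empty stack. *)
Definition push (f k : nat) : nat := ⟨f, k⟩.+1.

Definition ev_step (q : nat -> nat) (e x k : nat) : nat :=
  let c := pr1 e in let d := pr2 e in
  if c == 0 then Rt 0 k else
  if c == 1 then Rt x.+1 k else
  if c == 2 then Rt (pr1 x) k else
  if c == 3 then Rt (pr2 x) k else
  if c == 4 then if q x == 0 then Stuck else Rt (q x).-1 k else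
  if c == 5 then Ev (pr1 d) x (push ⟨0, ⟨pr2 d, x⟩⟩ k) else
  if c == 6 then Ev (pr2 d) x (push ⟨2, pr1 d⟩ k) else
  if c == 7 then
    if pr2 x == 0 then Ev (pr1 d) (pr1 x) k
    else Ev e ⟨pr1 x, (pr2 x).-1⟩
            (push ⟨3, ⟨pr2 d, ⟨pr1 x, (pr2 x).-1⟩⟩⟩ k) else
  if c == 8 then Ev d ⟨x, 0⟩ (push ⟨4, ⟨d, ⟨x, 0⟩⟩⟩ k) else
  Stuck.

(** The tag of the frame f says what awaits v: 0 and 1 are the two halves of a pairing, 2 the outer
    function of a composition, 3 the step function of a primitive recursion, and 4, the last tag
    ever pushed, a test of a minimization. *)
Definition rt_step (v f k : nat) : nat :=
  let t := pr1 f in let d := pr2 f in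
  if t == 0 then Ev (pr1 d) (pr2 d) (push ⟨1, v⟩ k) else
  if t == 1 then Rt ⟨d, v⟩ k else
  if t == 2 then Ev d v k else
  if t == 3 then Ev (pr1 d) ⟨pr1 (pr2 d), ⟨pr2 (pr2 d), v⟩⟩ k else
  if v == 0 then Rt (pr2 (pr2 d)) k
  else Ev (pr1 d) ⟨pr1 (pr2 d), (pr2 (pr2 d)).+1⟩
         (push ⟨4, ⟨pr1 d, ⟨pr1 (pr2 d), (pr2 (pr2 d)).+1⟩⟩⟩ k).

(** A value returned to the empty stack is a fixed point, so a halted run stays halted with the same
    result at all later stages. *)
Definition step (q : nat -> nat) (st : nat) : nat :=
  let w := pr1 (pr2 st) in let k := pr2 (pr2 st) in
  if pr1 st == 0 then ev_step q (pr1 w) (pr2 w) k else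
  if pr1 st == 1 then
    if k == 0 then st else rt_step w (pr1 k.-1) (pr2 k.-1) else
  st.

Lemma step_Ev q e x k : step q (Ev e x k) = ev_step q e x k.
Proof. by rewrite /step /Ev !npairK. Qed.

Lemma step_Rt q v f k : step q (Rt v (push f k)) = rt_step v f k.
Proof. by rewrite /step /Rt /push !npairK. Qed.

Lemma iter_step_Rt0 q v s : iter s (step q) (Rt v 0) = Rt v 0.
Proof. by elim: s => //= s ->; rewrite /step /Rt !npairK. Qed.

Lemma iter_step_Stuck q s : iter s (step q) Stuck = Stuck.
Proof. by elim: s => //= s ->; rewrite /step /Stuck !npairK. Qed.

Lemma Ev_neq_Rt e x k v k' : Ev e x k <> Rt v k'.
Proof. by move=> /npair_inj []. Qed.

Lemma Stuck_neq_Rt v k : Stuck <> Rt v k.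
Proof. by move=> /npair_inj []. Qed.

Lemma Rt_inj v k v' k' : Rt v k = Rt v' k' -> v = v' /\ k = k'.
Proof. by move=> /npair_inj [_ /npair_inj]. Qed.

Section MachineCorrect.
Variable h : nat -> nat.
Let q k := (h k).+1.
Local Notation step := (step q).

(** The stack k is arbitrary so that the induction hypotheses apply below the frames pushed for
    subcomputations. *)
Lemma machine_complete e x y :
  eval h e x y -> forall k, exists s, iter s step (Ev e x k) = Rt y k.
Proof.
have seq s s' a b c : iter s step a = b -> iter s' step b = c ->
    exists s, iter s step a = c.
  by move=> <- <-; exists (s' + s); rewrite iterD.
have one a b c : step a = b -> (exists s, iter s step b = c) ->
    exists s, iter s step a = c.
  by move=> E [s E']; apply: (seq 1) E' .
elim=> {e x y}.
- by move=> c x k; exists 1; rewrite /= step_Ev /ev_step !npairK.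
- by move=> c x k; exists 1; rewrite /= step_Ev /ev_step !npairK.
- by move=> c x y k; exists 1; rewrite /= step_Ev /ev_step !npairK.
- by move=> c x y k; exists 1; rewrite /= step_Ev /ev_step !npairK.
- by move=> c x k; exists 1; rewrite /= step_Ev /ev_step !npairK.
- move=> a b x u v _ IHa _ IHb k.
  apply: (one); first by rewrite step_Ev /ev_step !npairK.
  have [s E] := IHa (push ⟨0, ⟨b, x⟩⟩ k).
  have [s' E'] := IHb (push ⟨1, u⟩ k).
  have [t Et] : exists s, iter s step (Rt u (push ⟨0, ⟨b, x⟩⟩ k)) = Rt ⟨u, v⟩ k.
    apply: (one); first by rewrite step_Rt /rt_step !npairK.
    apply: (seq _ _ _ _ _ E'); instantiate (1 := 1).
    by rewrite /= step_Rt /rt_step !npairK.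
  exact: seq E Et.
- move=> a b x y z _ IHb _ IHa k.
  apply: (one); first by rewrite step_Ev /ev_step !npairK.
  have [s E] := IHb (push ⟨2, a⟩ k); have [s' E'] := IHa k.
  have [t Et] : exists s, iter s step (Rt y (push ⟨2, a⟩ k)) = Rt z k.
    apply: (one); first by rewrite step_Rt /rt_step !npairK.
    by exists s'.
  exact: seq E Et.
- move=> a b x y _ IH k.
  by apply: (one); [rewrite step_Ev /ev_step !npairK|apply: IH].
- move=> a b x n y z _ IHn _ IHb k.
  apply: (one); first by rewrite step_Ev /ev_step !npairK.
  have [s E] := IHn (push ⟨3, ⟨b, ⟨x, n⟩⟩⟩ k); have [s' E'] := IHb k.
  have [t Et] : exists s, iter s step (Rt y (push ⟨3, ⟨b, ⟨x, n⟩⟩⟩ k)) = Rt z k.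
    apply: (one); first by rewrite step_Rt /rt_step !npairK.
    by exists s'.
  exact: seq E Et.
- move=> a x n w _ IHw _ IHn k.
  apply: (one); first by rewrite step_Ev /ev_step !npairK.
  (* The machine tests upwards, so the induction is on the distance m to the zero at n. *)
  have loop m : m <= n ->
      exists s, iter s step (Ev a ⟨x, n - m⟩ (push ⟨4, ⟨a, ⟨x, n - m⟩⟩⟩ k)) =
        Rt n k.
    elim: m => [|m IH] le_mn.
      rewrite subn0; have [s E] := IHn (push ⟨4, ⟨a, ⟨x, n⟩⟩⟩ k).
      apply: (seq _ _ _ _ _ E); instantiate (1 := 1).
      by rewrite /= step_Rt /rt_step !npairK.
    have lt : n - m.+1 < n by lia.
    have [s E] := IHw _ lt (push ⟨4, ⟨a, ⟨x, n - m.+1⟩⟩⟩ k).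
    have [s' E'] := IH (ltnW le_mn).
    apply: (seq _ _ _ _ _ E); instantiate (1 := s'.+1).
    rewrite iterSr step_Rt /rt_step !npairK /=.
    by have -> : (n - m.+1).+1 = n - m by lia.
  by have := loop n (leqnn n); rewrite subnn.
Qed.

(** To end with the empty stack, the run must at some moment return a value to k. The bound [s' < s]
    makes strong induction on the number of steps available for the rest of the run. *)
Lemma machine_sound s e x k z : iter s step (Ev e x k) = Rt z 0 ->
  exists s' y, [/\ s' < s, eval h e x y & iter s' step (Rt y k) = Rt z 0].
Proof.
elim/ltn_ind: s e x k => [[|s]] IH e x k.
  by move=> /Ev_neq_Rt.
have IH1 s1 e' x' k' : s1 <= s -> iter s1 step (Ev e' x' k') = Rt z 0 ->
    exists s' y, [/\ s' < s1, eval h e' x' y & iter s' step (Rt y k') = Rt z 0].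
  by move=> le; apply: IH.
rewrite iterSr step_Ev /ev_step -(prK e) !npairK.
move: (pr1 e) (pr2 e) => c d {e}.
case: eqP => [->|_]; first by exists s, 0; split=> //; constructor.
case: eqP => [->|_]; first by exists s, x.+1; split=> //; constructor.
case: eqP => [->|_].
  by exists s, (pr1 x); split=> //; rewrite -{1}(prK x); constructor.
case: eqP => [->|_].
  by exists s, (pr2 x); split=> //; rewrite -{1}(prK x); constructor.
case: eqP => [->|_]; first by exists s, (h x); split=> //; constructor.
case: eqP => [->|_].
  rewrite -(prK d) !npairK; move: (pr1 d) (pr2 d) => a b /IH1 [//|s1 [u [lt1 Ha]]].
  case: s1 lt1 => [_ /Rt_inj[]//|s1 lt1].
  rewrite iterSr step_Rt /rt_step !npairK /= => /IH1 [|s2 [v [lt2 Hb]]]; first lia.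
  case: s2 lt2 => [_ /Rt_inj[]//|s2 lt2].
  rewrite iterSr step_Rt /rt_step !npairK /= => E.
  by exists s2, ⟨u, v⟩; split=> //; [lia|apply: eval_pair].
case: eqP => [->|_].
  rewrite -(prK d) !npairK; move: (pr1 d) (pr2 d) => a b /IH1 [//|s1 [u [lt1 Hb]]].
  case: s1 lt1 => [_ /Rt_inj[]//|s1 lt1].
  rewrite iterSr step_Rt /rt_step !npairK /= => /IH1 [|s2 [v [lt2 Ha E]]];
    first lia.
  by exists s2, v; split=> //; [lia|apply: eval_comp Ha].
case: eqP => [->|_].
  rewrite -(prK d) -(prK x) !npairK; move: (pr1 d) (pr2 d) (pr1 x) (pr2 x) =>
    a b x0 n.
  case: eqP => [->|].
    move=> /IH1 [//|s1 [u [lt1 Hb]] E].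
    by exists s1, u; split=> //; [lia|apply: eval_prec0].
  case: n => //= n _ /IH1 [//|s1 [u [lt1 Hn]]].
  case: s1 lt1 => [_ /Rt_inj[]//|s1 lt1].
  rewrite iterSr step_Rt /rt_step !npairK /= => /IH1 [|s2 [v [lt2 Ha E]]];
    first lia.
  by exists s2, v; split=> //; [lia|apply: eval_precS Ha].
case: eqP => [->|_]; last by rewrite iter_step_Stuck => /Stuck_neq_Rt.
move=> E0.
have loop s1 m : s1 <= s ->
    iter s1 step (Ev d ⟨x, m⟩ (push ⟨4, ⟨d, ⟨x, m⟩⟩⟩ k)) = Rt z 0 ->
    exists s' n, [/\ s' < s1, m <= n, 
      forall j, m <= j < n -> exists w, eval h d ⟨x, j⟩ w.+1,
      eval h d ⟨x, n⟩ 0 & iter s' step (Rt n k) = Rt z 0].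
  elim/ltn_ind: s1 m => s1 IHs m les /IH1 [//|s2 [v [lt2 Hv]]].
  case: s2 lt2 => [_ /Rt_inj[]//|s2 lt2].
  rewrite iterSr step_Rt /rt_step !npairK /=; case: eqP => [v0|].
    exists s2, m; split=> //; [lia| |by rewrite -v0].
    by move=> j; lia.
  case: v Hv => // v Hv _ /IHs [||s3 [n [lt3 le Hj H0 E]]]; try lia.
  exists s3, n; split=> //; try lia.
  move=> j /andP[lemj ltjn]; have [<-|ne] := eqVneq m j; first by exists v.
  by apply: Hj; lia.
have [//|s' [n [lt _ Hj H0 E]]] := loop s 0 _ E0.
exists s', n; split=> //; first lia.
(* [eval_mu] wants the nonzero tests as values of one function; it is 0 from n on. *)
have [|w Hw] := @choice _ _ (fun j w => j < n -> eval h d ⟨x, j⟩ w.+1).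
  by move=> j; case: (ltnP j n) => [/Hj [w]|]; [exists w|exists 0].
exact: eval_mu Hw H0.
Qed.

Lemma eval_machine e x y :
  eval h e x y <-> exists s, iter s step (Ev e x 0) = Rt y 0.
Proof.
split=> [/machine_complete|[s /machine_sound [s' [y' [_ He]]]]]; first exact.
by rewrite iter_step_Rt0 => /Rt_inj [<-].
Qed.

(** Both runs are prolonged to the common length s + s', since their final states are fixed. *)
Lemma eval_det e x y y' : eval h e x y -> eval h e x y' -> y = y'.
Proof.
move=> /eval_machine [s E] /eval_machine [s' E'].
have [] : Rt y 0 = Rt y' 0; last by move=> /Rt_inj[].
by rewrite -(iter_step_Rt0 q y s') -E -iterD addnC iterD E' iter_step_Rt0.
Qed.

End MachineCorrect.

Lemma eval_mu_inv g a x n : eval g ⟨8, a⟩ x n -> eval g a ⟨x, n⟩ 0.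
Proof.
move E: ⟨8, a⟩ => e H; case: H E => {e x n} //; intros;
  match goal with H : npair _ _ = npair _ _ |- _ => case/npair_inj: H => //= end.
by move=> _ ->.
Qed.

Lemma eval_comp_inv g a b x z :
  eval g ⟨6, ⟨a, b⟩⟩ x z -> exists2 y, eval g b x y & eval g a y z.
Proof.
move E: ⟨6, ⟨a, b⟩⟩ => e H; case: H E => {e x z} //; intros;
  match goal with H : npair _ _ = npair _ _ |- _ => case/npair_inj: H => //= end.
by move=> _ /npair_inj [-> ->]; exists y.
Qed.

(** * Search and universal indices *)

Section Machine.
Variable K : (nat -> nat) -> Prop.
Implicit Types F G N : (nat -> nat) -> nat -> nat.
Local Notation computable := (computable K).
Local Notation computableb := (computableb K).

Lemma computable_step (q : (nat -> nat) -> nat -> nat -> nat) F :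
  computable (fun g z => q g (pr1 z) (pr2 z)) -> computable F ->
  computable (fun g x => step (q g x) (F g x)).
Proof.
move=> cq cF; rewrite /step /ev_step /rt_step /Ev /Rt /push /Stuck.
have cQ A : computable A -> computable (fun g x => q g x (A g x)).
  by move=> cA; apply: (computable_comp2 (H := q)) cq _ cA; comp.
by comp; first [apply: cQ; comp | comp].
Qed.

Definition run (q : nat -> nat) (e x s : nat) : nat := iter s (step q) (Ev e x 0).

Definition halted (st : nat) : bool := (pr1 st == 1) && (pr2 (pr2 st) == 0).

Definition result (st : nat) : nat := pr1 (pr2 st).

Lemma haltedE st : halted st -> st = Rt (result st) 0.
Proof.
case/andP=> /eqP E1 /eqP E2.
by rewrite -(prK st) E1 -(prK (pr2 st)) E2 /Rt /result !npairK.
Qed.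

Lemma halted_Rt v : halted (Rt v 0).
Proof. by rewrite /halted /Rt !npairK. Qed.

Lemma result_Rt v k : result (Rt v k) = v.
Proof. by rewrite /result /Rt !npairK. Qed.

Lemma computable_run (q : (nat -> nat) -> nat -> nat -> nat) E X S :
  computable (fun g z => q g (pr1 z) (pr2 z)) ->
  computable E -> computable X -> computable S ->
  computable (fun g x => run (q g x) (E g x) (X g x) (S g x)).
Proof.
move=> cq cE cX cS; rewrite /run /Ev; comp.
apply: (@computable_step (fun g z => q g (pr1 z))); comp.
by apply: (computable_comp2 (H := q)) cq _ _; comp.
Qed.

Lemma computable_halted F : computable F -> computableb (fun g x => halted (F g x)).
Proof. by move=> cF; rewrite /halted; comp. Qed.

Lemma run_halted h e x y s :
  run (succn \o h) e x s = Rt y 0 -> eval h e x y.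
Proof. by move=> E; apply/eval_machine; exists s. Qed.

Lemma eval_run h e x y :
  eval h e x y <-> exists2 s, halted (run (succn \o h) e x s) &
                              result (run (succn \o h) e x s) = y.
Proof.
split=> [/eval_machine [s E]|[s /haltedE E <-]].
  by exists s; rewrite /run E ?halted_Rt ?result_Rt.
by apply: run_halted E.
Qed.

(** Minimization whose output is the second component of the witness found; the first component is
    room for a halting stage. *)
Lemma search b : computableb b ->
  exists e, forall g, K g -> forall x,
    (forall y, eval g e x y -> exists2 t, b g ⟨x, t⟩ & y = pr2 t) /\
    ((exists t, b g ⟨x, t⟩) -> exists y, eval g e x y).
Proof.
move=> cb; have [a Ha] : computable (fun g z => ~~ b g z : nat) by comp.
have [p Hp] : computable (fun _ t => pr2 t) by comp.
exists ⟨6, ⟨p, ⟨8, a⟩⟩⟩ => g Kg x; split=> [y /eval_comp_inv [t /eval_mu_inv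
  Et]|exb].
  move/eval_det => /(_ _ (Hp _ Kg _)) ->; exists t => //.
  by have := eval_det Et (Ha _ Kg _); case: (b g _).
case: (ex_minnP exb) => n bn min; exists (pr2 n).
apply: eval_comp (Hp _ Kg _).
apply: (@eval_mu _ _ _ _ (fun _ => 0)) => [m lt|].
  have := Ha _ Kg ⟨x, m⟩; case bm: (b g _) => //.
  by have := min m bm; lia.
by have := Ha _ Kg ⟨x, n⟩; rewrite bn.
Qed.

(** The search is for a halting stage paired with its result. The parameter p lets the simulated
    oracle [q g p] vary with the input. *)
Lemma universal (q : (nat -> nat) -> nat -> nat -> nat) :
  computable (fun g z => q g (pr1 z) (pr2 z)) ->
  exists u, forall g, K g -> forall p e x y,
    eval g u ⟨p, ⟨e, x⟩⟩ y <-> eval (q g p) e x y.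
Proof.
move=> cq.
pose R g z s := run (succn \o q g (pr1 z)) (pr1 (pr2 z)) (pr2 (pr2 z)) s.
have cR : computable (fun g w => R g (pr1 w) (pr1 (pr2 w))).
  apply: (@computable_run (fun g w k => (q g (pr1 (pr1 w)) k).+1)); comp.
  by apply: (computable_comp2 (H := q)) cq _ _; comp.
have [|u Hu] := @search (fun g w => let st := R g (pr1 w) (pr1 (pr2 w)) in
    halted st && (result st == pr2 (pr2 w))).
  by rewrite /= /halted /result; comp.
exists u => g Kg p e x y; have [Hu1 Hu2] := Hu g Kg ⟨p, ⟨e, x⟩⟩.
have snd z : eval g u ⟨p, ⟨e, x⟩⟩ z -> eval (q g p) e x z.
  move=> /Hu1 [t + ->]; rewrite /R !npairK => /andP [hs /eqP <-].
  by apply/eval_run; exists (pr1 t).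
split=> [/snd //|He]; have /eval_run [s hs Es] := He.
have [|z Hz] := Hu2; last by have := eval_det He (snd _ Hz) => ->.
by exists ⟨s, y⟩; rewrite /R !npairK hs Es eqxx.
Qed.

End Machine.

(** A computed oracle may replace the given one: the universal index runs the index of F with oracle
    [q g x]. Transitivity of Turing reducibility and substitution into Pi^1_1 predicates both come
    from here. *)
Lemma computable_subst (K K' : (nat -> nat) -> Prop)
    (F : (nat -> nat) -> nat -> nat) (q : (nat -> nat) -> nat -> nat -> nat) A :
  (forall g p, K g -> K' (q g p)) ->
  computable K' F -> computable K (fun g z => q g (pr1 z) (pr2 z)) ->
  computable K A -> computable K (fun g x => F (q g x) (A g x)).
Proof.
move=> Kq [e He] cq cA; have [u Hu] := universal cq.
have [p Hp] : computable K (fun g x => ⟨x, ⟨e, A g x⟩⟩) by comp.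
exists ⟨6, ⟨u, p⟩⟩ => g Kg x; apply: eval_comp (Hp _ Kg _) _.
by apply/(Hu _ Kg); apply: He; apply: Kq.
Qed.

(** * Uniformly Pi^1_1 predicates *)

Notation recursive := (computable (fun _ => True)).
Notation recursiveb := (computableb (fun _ => True)).

Definition ev (h : nat -> nat) (k : nat) : nat := h k.*2.
Definition od (h : nat -> nat) (k : nat) : nat := h k.*2.+1.
Definition fjoin (g f : nat -> nat) (n : nat) : nat :=
  if odd n then f n./2 else g n./2.

Lemma ev_fjoin g f : ev (fjoin g f) = g.
Proof. by apply/funext => k; rewrite /ev /fjoin odd_double doubleK. Qed.

Lemma od_fjoin g f : od (fjoin g f) = f.
Proof. by apply/funext => k; rewrite /od /fjoin /= odd_double uphalf_double. Qed.

Definition fjoinK := (ev_fjoin, od_fjoin).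

Lemma recursive_subst F (q : (nat -> nat) -> nat -> nat -> nat) A :
  recursive F -> recursive (fun g z => q g (pr1 z) (pr2 z)) -> recursive A ->
  recursive (fun g x => F (q g x) (A g x)).
Proof. exact: computable_subst. Qed.

Lemma recursive_comp2 (H : (nat -> nat) -> nat -> nat -> nat) F G :
  recursive (fun g z => H g (pr1 z) (pr2 z)) -> recursive F -> recursive G ->
  recursive (fun g x => H g (F g x) (G g x)).
Proof. exact: computable_comp2. Qed.

(** Normal form with a decidable matrix, uniform in g. As g is any function, a quantified function
    can be joined to the oracle, which is how function quantifiers are absorbed. *)
Definition Pi (P : (nat -> nat) -> nat -> Prop) : Prop :=
  exists2 D, recursiveb D &
    forall g n, P g n <-> forall f, exists s, D (fjoin g f) ⟨n, s⟩.

Definition Sig (P : (nat -> nat) -> nat -> Prop) : Prop := Pi (fun g n => ~ P g n).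

Lemma Pi_iff P Q : (forall g n, P g n <-> Q g n) -> Pi P -> Pi Q.
Proof. by move=> PQ [D cD HD]; exists D => // g n; rewrite -PQ. Qed.

Lemma Pi_subst P (q : (nat -> nat) -> nat -> nat -> nat) A :
  Pi P -> recursive (fun g z => q g (pr1 z) (pr2 z)) -> recursive A ->
  Pi (fun g n => P (q g n) (A g n)).
Proof.
move=> [D cD HD] cq cA.
exists (fun h z => D (fjoin (q (ev h) (pr1 z)) (od h)) ⟨A (ev h) (pr1 z), pr2 z⟩).
  apply: (@recursive_subst D (fun h z => fjoin (q (ev h) (pr1 z)) (od h))).
  - exact: cD.
  - rewrite /fjoin /od; comp.
    pose G g z := q g (pr1 z) (pr2 z).
    pose Q (h : nat -> nat) (z : nat) := ev h.
    have := @recursive_subst G Q (fun h z => ⟨pr1 (pr1 z), (pr2 z)./2⟩) cq.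
    rewrite /G /Q /ev => HH.
    apply: computable_ext (HH _ _); comp.
    by move=> g x _; rewrite !npairK.
  - comp; pose Q (h : nat -> nat) (z : nat) := ev h.
    by apply: (@recursive_subst A Q (fun _ z => pr1 z)) => //; rewrite ?/Q ?/ev;
      comp.
by move=> g n; rewrite HD; split=> H f; have [s Hs] := H f; exists s;
  move: Hs; rewrite !fjoinK !npairK.
Qed.

Lemma Pi_dec b : recursiveb b -> Pi (fun g n => b g n).
Proof.
move=> cb; exists (fun h z => b (ev h) (pr1 z)).
  pose Q (h : nat -> nat) (z : nat) := ev h.
  by apply: (@recursive_subst b Q (fun _ z => pr1 z)) => //; rewrite ?/Q ?/ev; comp.
move=> g n; split=> [H f|/(_ id) [s]]; last by rewrite fjoinK npairK.
by exists 0; rewrite fjoinK npairK.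
Qed.

Lemma Pi_and P Q : Pi P -> Pi Q -> Pi (fun g n => P g n /\ Q g n).
Proof.
move=> [D cD HD] [E cE HE].
exists (fun h z => D h ⟨pr1 z, pr1 (pr2 z)⟩ && E h ⟨pr1 z, pr2 (pr2 z)⟩).
  by apply: computableb_and; apply: computableb_comp; comp.
move=> g n; rewrite HD HE; split=> [[H1 H2] f|H].
  have [s Hs] := H1 f; have [t Ht] := H2 f.
  by exists ⟨s, t⟩; rewrite !npairK Hs Ht.
by split=> f; have [s] := H f; rewrite !npairK => /andP [Hs Ht]; eexists; eauto.
Qed.

(** The two matrices read separate halves of f, so counterexamples to both disjuncts join to a
    counterexample to the disjunction. *)
Lemma Pi_or P Q : Pi P -> Pi Q -> Pi (fun g n => P g n \/ Q g n).
Proof.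
move=> [D cD HD] [E cE HE].
exists (fun h z => D (fjoin (ev h) (ev (od h))) z || E (fjoin (ev h) (od (od
  h))) z).
  comp.
    apply: (@recursive_subst D (fun h _ => fjoin (ev h) (ev (od h)))); rewrite //.
    - by rewrite ?/fjoin ?/ev ?/od; comp.
    - by comp.
  apply: (@recursive_subst E (fun h _ => fjoin (ev h) (od (od h)))); rewrite //.
  - by rewrite ?/fjoin ?/ev ?/od; comp.
  - by comp.
move=> g n; rewrite HD HE; split=> [[H|H] f|H].
- by have [s Hs] := H (ev f); exists s; rewrite !fjoinK Hs.
- by have [s Hs] := H (od f); exists s; rewrite !fjoinK Hs orbT.
- apply: contrapT => /not_orP [/existsNP [f1 H1] /existsNP [f2 H2]].
  have [s] := H (fjoin f1 f2); rewrite !fjoinK => /orP [] Hs.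
    by apply: H1; exists s.
  by apply: H2; exists s.
Qed.

(** The number m is stored as the value at 0, and the function proper is shifted by one. *)
Lemma Pi_all (P : (nat -> nat) -> nat -> nat -> Prop) :
  Pi (fun g z => P g (pr1 z) (pr2 z)) -> Pi (fun g n => forall m, P g n m).
Proof.
move=> [D cD HD].
exists (fun h z => D (fjoin (ev h) (fun k => od h k.+1)) ⟨⟨pr1 z, od h 0⟩, pr2 z⟩).
  apply: (@recursive_subst D (fun h _ => fjoin (ev h) (fun k => od h k.+1))).
  - exact: cD.
  - by rewrite ?/fjoin ?/ev ?/od; comp.
  - by rewrite /od; comp.
move=> g n; split=> [H f|H m].
  have /HD /(_ (fun k => f k.+1)) [s Hs] :
    P g (pr1 ⟨n, f 0⟩) (pr2 ⟨n, f 0⟩) by rewrite !npairK.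
  by exists s; rewrite !fjoinK !npairK.
rewrite -(npairK1 n m) -{2}(npairK2 n m); apply/HD => f.
have [s] := H (fun k => if k is k'.+1 then f k' else m).
by rewrite !fjoinK !npairK; exists s.
Qed.

(** The m-th column of f plays against m. If every m fails, choice collects the counterexamples as
    the columns of a single f. *)
Lemma Pi_ex (P : (nat -> nat) -> nat -> nat -> Prop) :
  Pi (fun g z => P g (pr1 z) (pr2 z)) -> Pi (fun g n => exists m, P g n m).
Proof.
move=> [D cD HD].
exists (fun h z => D (fjoin (ev h) (fun k => od h ⟨pr1 (pr2 z), k⟩))
                 ⟨⟨pr1 z, pr1 (pr2 z)⟩, pr2 (pr2 z)⟩).
  apply: (@recursive_subst D
    (fun h z => fjoin (ev h) (fun k => od h ⟨pr1 (pr2 z), k⟩))).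
  - exact: cD.
  - by rewrite ?/fjoin ?/ev ?/od; comp.
  - by comp.
move=> g n; split=> [[m Hm] f|H].
  have /HD /(_ (fun k => f ⟨m, k⟩)) [s Hs] :
    P g (pr1 ⟨n, m⟩) (pr2 ⟨n, m⟩) by rewrite !npairK.
  by exists ⟨m, s⟩; rewrite !fjoinK !npairK.
apply: contrapT => /forallNP nP.
have /choice [F HF] m : exists f, ~ exists s, D (fjoin g f) ⟨⟨n, m⟩, s⟩.
  by apply/existsNP => /HD; rewrite !npairK => /nP.
have [s] := H (fun k => F (pr1 k) (pr2 k)); rewrite !fjoinK !npairK => Hs.
apply: (HF (pr1 s)); exists (pr2 s); move: Hs.
by congr (is_true (D (fjoin g _) _)); apply/funext => k; rewrite !npairK.
Qed.

Lemma Pi_allf (P : (nat -> nat) -> (nat -> nat) -> nat -> Prop) :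
  Pi (fun h n => P (ev h) (od h) n) -> Pi (fun g n => forall f, P g f n).
Proof.
move=> [D cD HD].
exists (fun h z => D (fjoin (fjoin (ev h) (ev (od h))) (od (od h))) z).
  apply: (@recursive_subst D
    (fun h _ => fjoin (fjoin (ev h) (ev (od h))) (od (od h)))).
  - exact: cD.
  - by rewrite ?/fjoin ?/ev ?/od; comp.
  - by comp.
move=> g n; split=> [H f|H f].
  have /HD /(_ (od f)) [s Hs] : P (ev (fjoin g (ev f))) (od (fjoin g (ev f))) n.
    by rewrite !fjoinK.
  by exists s; rewrite !fjoinK.
rewrite -(ev_fjoin g f) -{2}(od_fjoin g f); apply/HD => f'.
by have [s] := H (fjoin f f'); rewrite !fjoinK; exists s.
Qed.

Lemma Sig_iff P Q : (forall g n, P g n <-> Q g n) -> Sig P -> Sig Q.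
Proof. by move=> PQ; apply: Pi_iff => g n; rewrite PQ. Qed.

Lemma Sig_not P : Pi P -> Sig (fun g n => ~ P g n).
Proof. by apply: Pi_iff => g n; rewrite notK. Qed.

Lemma Pi_not P : Sig P -> Pi (fun g n => ~ P g n).
Proof. by []. Qed.

Lemma Pi_imp P Q : Sig P -> Pi Q -> Pi (fun g n => P g n -> Q g n).
Proof. by move=> sP pQ; apply: Pi_iff (Pi_or sP pQ) => g n; rewrite implyE. Qed.

Lemma Sig_imp P Q : Pi P -> Sig Q -> Sig (fun g n => P g n -> Q g n).
Proof. by move=> pP sQ; apply: Pi_iff (Pi_and pP sQ) => g n;
  rewrite not_implyE. Qed.

Lemma Sig_and P Q : Sig P -> Sig Q -> Sig (fun g n => P g n /\ Q g n).
Proof. by move=> sP sQ; apply: Pi_iff (Pi_or sP sQ) => g n; rewrite not_andE. Qed.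

Lemma Sig_or P Q : Sig P -> Sig Q -> Sig (fun g n => P g n \/ Q g n).
Proof. by move=> sP sQ; apply: Pi_iff (Pi_and sP sQ) => g n; rewrite not_orE. Qed.

Lemma Sig_ex (P : (nat -> nat) -> nat -> nat -> Prop) :
  Sig (fun g z => P g (pr1 z) (pr2 z)) -> Sig (fun g n => exists m, P g n m).
Proof.
move=> sP; apply: Pi_iff (@Pi_all (fun g n m => ~ P g n m) sP) => g n.
exact: forallNP.
Qed.

Lemma Sig_all (P : (nat -> nat) -> nat -> nat -> Prop) :
  Sig (fun g z => P g (pr1 z) (pr2 z)) -> Sig (fun g n => forall m, P g n m).
Proof.
move=> sP; apply: Pi_iff (@Pi_ex (fun g n m => ~ P g n m) sP) => g n.
by rewrite existsNE.
Qed.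

Lemma Sig_exf (P : (nat -> nat) -> (nat -> nat) -> nat -> Prop) :
  Sig (fun h n => P (ev h) (od h) n) -> Sig (fun g n => exists f, P g f n).
Proof.
move=> sP; apply: Pi_iff (@Pi_allf (fun g f n => ~ P g f n) sP) => g n.
exact: forallNP.
Qed.

Lemma Sig_dec b : recursiveb b -> Sig (fun g n => b g n).
Proof.
move=> cb; have cnb : recursiveb (fun g n => ~~ b g n) by comp.
by apply: Pi_iff (Pi_dec cnb) => g n; split => /negP.
Qed.

Lemma Pi_eq F G : recursive F -> recursive G -> Pi (fun g n => F g n = G g n).
Proof.
move=> cF cG; have cE : recursiveb (fun g n => F g n == G g n) by comp.
by apply: Pi_iff (Pi_dec cE) => g n; split=> /eqP.
Qed.

Lemma Sig_eq F G : recursive F -> recursive G -> Sig (fun g n => F g n = G g n).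
Proof.
move=> cF cG; have cE : recursiveb (fun g n => F g n == G g n) by comp.
by apply: Sig_iff (Sig_dec cE) => g n; split=> /eqP.
Qed.

(** * Definability of evaluation and of relations given by indices *)

Section EvalDefinable.
Variables (q : (nat -> nat) -> nat -> nat -> nat) (E X Y : (nat -> nat) -> nat
  -> nat).
Hypotheses (cq : recursive (fun g z => q g (pr1 z) (pr2 z))).
Hypotheses (cE : recursive E) (cX : recursive X) (cY : recursive Y).

Let evalb g n s :=
  let st := run (succn \o q g n) (E g n) (X g n) s in
  halted st && (result st == Y g n).

Let rec_evalb : recursiveb (fun g z => evalb g (pr1 z) (pr2 z)).
Proof.
have c1 A : recursive A -> recursive (fun g z => A g (pr1 z)).
  by move=> cA; apply: computable_comp; comp.
have := c1 _ cE; have := c1 _ cX; have := c1 _ cY => cY' cX' cE'.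
rewrite /evalb /halted /result.
have cR : recursive (fun g z =>
    run (succn \o q g (pr1 z)) (E g (pr1 z)) (X g (pr1 z)) (pr2 z)).
  apply: (@computable_run _ (fun g z k => (q g (pr1 z) k).+1)); comp.
  by apply: (recursive_comp2 (H := q)); comp.
by comp.
Qed.

Let evalbP g n :
  (exists s, evalb g n s) <-> eval (q g n) (E g n) (X g n) (Y g n).
Proof.
split=> [[s /andP [hs /eqP <-]]|/eval_run [s hs Es]].
  by apply/eval_run; exists s.
by exists s; rewrite /evalb hs Es eqxx.
Qed.

(** Convergence to a given value is Sigma^0_1, and both classes absorb number quantifiers. *)
Lemma Pi_eval : Pi (fun g n => eval (q g n) (E g n) (X g n) (Y g n)).
Proof. by apply: Pi_iff evalbP _; apply/Pi_ex/Pi_dec. Qed.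

Lemma Sig_eval : Sig (fun g n => eval (q g n) (E g n) (X g n) (Y g n)).
Proof. by apply: Sig_iff evalbP _; apply/Sig_ex/Sig_dec. Qed.

End EvalDefinable.

Definition rel_index (g : nat -> nat) (e : nat) : rel nat :=
  fun x y => `[< eval g e ⟨x, y⟩ 1 >].

(** Under this condition [rel_index g e] is recursive in g, and not merely recursively enumerable in
    it. *)
Definition total01 (g : nat -> nat) (e : nat) : Prop :=
  forall k, eval g e k 0 \/ eval g e k 1.

Lemma rel_indexE g e x y : rel_index g e x y <-> eval g e ⟨x, y⟩ 1.
Proof. by split=> /asboolP. Qed.

Lemma Pi_rel_index q E X Y :
  recursive (fun g z => q g (pr1 z) (pr2 z)) ->
  recursive E -> recursive X -> recursive Y ->
  Pi (fun g n => rel_index (q g n) (E g n) (X g n) (Y g n)).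
Proof.
move=> cq cE cX cY; apply: Pi_iff (fun g n => iff_sym (rel_indexE _ _ _ _)) _.
by apply: Pi_eval; comp.
Qed.

Lemma Sig_rel_index q E X Y :
  recursive (fun g z => q g (pr1 z) (pr2 z)) ->
  recursive E -> recursive X -> recursive Y ->
  Sig (fun g n => rel_index (q g n) (E g n) (X g n) (Y g n)).
Proof.
move=> cq cE cX cY; apply: Sig_iff (fun g n => iff_sym (rel_indexE _ _ _ _)) _.
by apply: Sig_eval; comp.
Qed.

Ltac definable_leaf := rewrite ?/ev ?/od; comp.
(** A premise of an implication is sent to the opposite class. A function quantifier of the wrong
    kind has no clause, so the tactic cannot pass it. *)
Ltac definable_step :=
  match goal with
  | H : Pi _ |- _ => exact H
  | H : Sig _ |- _ => exact H
  | |- Pi (fun g n => eval _ _ _ _) => apply: Pi_eval; definable_leaf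
  | |- Sig (fun g n => eval _ _ _ _) => apply: Sig_eval; definable_leaf
  | |- Pi (fun g n => is_true (rel_index _ _ _ _)) => apply: Pi_rel_index;
    definable_leaf
  | |- Sig (fun g n => is_true (rel_index _ _ _ _)) => apply: Sig_rel_index;
    definable_leaf
  | |- Pi (fun g n => is_true _) => apply: Pi_dec; definable_leaf
  | |- Sig (fun g n => is_true _) => apply: Sig_dec; definable_leaf
  | |- Pi (fun g n => @eq nat _ _) => apply: Pi_eq; definable_leaf
  | |- Sig (fun g n => @eq nat _ _) => apply: Sig_eq; definable_leaf
  | |- Pi (fun g n => ~ _) => apply: Pi_not
  | |- Sig (fun g n => ~ _) => apply: Sig_not
  | |- Pi (fun g n => _ /\ _) => apply: Pi_and
  | |- Sig (fun g n => _ /\ _) => apply: Sig_and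
  | |- Pi (fun g n => _ <-> _) => apply: Pi_and
  | |- Sig (fun g n => _ <-> _) => apply: Sig_and
  | |- Pi (fun g n => _ \/ _) => apply: Pi_or
  | |- Sig (fun g n => _ \/ _) => apply: Sig_or
  | |- Pi (fun g n => exists m : nat, _) => apply: Pi_ex
  | |- Sig (fun g n => exists m : nat, _) => apply: Sig_ex
  | |- Sig (fun g n => exists f : nat -> nat, _) => apply: Sig_exf
  | |- Pi (fun g n => forall f : nat -> nat, _) => apply: Pi_allf
  | |- Pi (fun g n => forall m : nat, _) => apply: Pi_all
  | |- Sig (fun g n => forall m : nat, _) => apply: Sig_all
  | |- Pi (fun g n => forall H : _, _) => apply: Pi_imp
  | |- Sig (fun g n => forall H : _, _) => apply: Sig_imp
  end.
Ltac definable := repeat definable_step.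

(** * Codes of finite sequences *)

(* 0 codes the empty sequence; every number codes exactly one sequence. *)
Definition child (s k : nat) : nat := ⟨s, k⟩.+1.
Definition parent (s : nat) : nat := pr1 s.-1.
Definition lastc (s : nat) : nat := pr2 s.-1.
Definition count_len (s : nat) : nat -> nat :=
  nat_rec (fun _ => nat) 0 (fun i n => n + (iter i parent s != 0)).
(** Counting through s iterates suffices, because the parent of a nonzero code is smaller than the
    code; this keeps the length primitive recursive. *)
Definition len (s : nat) : nat := count_len s s.

(* 0 past the end of the sequence, the successor of the entry before it *)
Definition entry (s i : nat) : nat :=
  if i < len s then (lastc (iter (len s - i.+1) parent s)).+1 else 0.

Lemma parent_child s k : parent (child s k) = s.
Proof. exact: npairK1. Qed.

Lemma lastc_child s k : lastc (child s k) = k.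
Proof. exact: npairK2. Qed.

Lemma seq_ind (P : nat -> Prop) :
  P 0 -> (forall s k, P s -> P (child s k)) -> forall s, P s.
Proof.
move=> P0 PS; elim/ltn_ind => -[//|s] IH.
by rewrite -(prK s); apply: PS; apply: IH; rewrite ltnS pr1_le.
Qed.

Lemma iter_parent0 i s : s <= i -> iter i parent s = 0.
Proof.
elim: i s => [|i IH] s le; first by rewrite /=; lia.
rewrite iterSr; apply: IH; case: s le => // s; rewrite ltnS => le.
by apply: leq_trans le; exact: pr1_le.
Qed.

Lemma len_child s k : len (child s k) = (len s).+1.
Proof.
have E n : count_len (child s k) n.+1 = (count_len s n).+1.
  elim: n => [//|n IH].
  have -> : count_len (child s k) n.+2 =
     count_len (child s k) n.+1 + (iter n.+1 parent (child s k) != 0) by [].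
  by rewrite IH iterSr parent_child.
have stable m : s <= m -> count_len s m = len s.
  elim: m => [|m IH]; first by rewrite leqn0 => /eqP ->.
  rewrite leq_eqVlt => /orP [/eqP <- //|]; rewrite ltnS => le.
  have -> : count_len s m.+1 = count_len s m + (iter m parent s != 0) by [].
  by rewrite (IH le) iter_parent0 // addn0.
have le : s <= (child s k).-1 by have := npair_ge s k; rewrite /child /=; lia.
by rewrite -(stable _ le) -E.
Qed.

Lemma entry0 i : entry 0 i = 0.
Proof. by []. Qed.

Lemma entry_child s k i :
  entry (child s k) i = if i == len s then k.+1 else entry s i.
Proof.
rewrite /entry len_child; case: eqP => [->|ne].
  by rewrite ltnSn subnn lastc_child.
case: (ltnP i (len s)) => lt; last by case: ltnP => //; lia.
rewrite ltnW // subSS.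
have -> : len s - i = (len s - i.+1).+1 by lia.
by rewrite iterSr parent_child.
Qed.

Lemma entry_gt0 s i : (0 < entry s i) = (i < len s).
Proof. by rewrite /entry; case: (i < len s). Qed.

Lemma len_le s : len s <= s.
Proof.
elim/seq_ind: s => // s k IH; rewrite len_child /child ltnS.
by have := npair_ge s k; lia.
Qed.

Lemma entry_inj s t : (forall i, entry s i = entry t i) -> s = t.
Proof.
elim/seq_ind: s t => [|s k IH] t; elim/seq_ind: t => [|t k' _] // E.
- by have := E (len t); rewrite entry_child eqxx.
- by have := E (len s); rewrite entry_child eqxx.
have El : len s = len t.
  suff : (len s).+1 = (len t).+1 by case.
  rewrite -(len_child s k) -(len_child t k').
  apply/eqP; rewrite eqn_leq; apply/andP; split; rewrite leqNgt -entry_gt0.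
    by rewrite E entry_gt0 ltnn.
  by rewrite -E entry_gt0 ltnn.
have := E (len s); rewrite !entry_child El eqxx => -[<-].
congr child; apply: IH => i.
have := E i; rewrite !entry_child El; case: eqP => // -> _.
by rewrite /entry El ltnn.
Qed.

Section ComputableSeq.
Variable K : (nat -> nat) -> Prop.
Implicit Types F G : (nat -> nat) -> nat -> nat.

Lemma computable_len F : computable K F -> computable K (fun g x => len (F g x)).
Proof.
move=> cF; rewrite /len /count_len.
apply: (@computable_rec K (fun _ _ => 0) F
   (fun g x i n => n + (iter i parent (F g x) != 0))); comp.
comp; first by apply: (@computable_comp K F (fun _ z => pr1 z)); comp.
by rewrite /parent; comp.
Qed.

Lemma computable_entry F G : computable K F -> computable K G ->
  computable K (fun g x => entry (F g x) (G g x)).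
Proof.
move=> cF cG; rewrite /entry /lastc /parent; have := computable_len cF => cL.
by comp.
Qed.

Lemma computable_child F G : computable K F -> computable K G ->
  computable K (fun g x => child (F g x) (G g x)).
Proof. by move=> cF cG; rewrite /child; comp. Qed.

End ComputableSeq.

Definition initseq (f : nat -> nat) (k : nat) : nat :=
  nat_rec (fun _ => nat) 0 (fun i s => child s (f i)) k.

Lemma len_initseq f k : len (initseq f k) = k.
Proof. by elim: k => //= k IH; rewrite len_child IH. Qed.

Lemma entry_initseq f k i : entry (initseq f k) i = if i < k then (f i).+1 else 0.
Proof.
elim: k => [|k IH] /=; first by rewrite entry0.
by rewrite entry_child len_initseq IH ltnS; case: ltngtP => // ->.
Qed.

(** * Trees and the Kleene-Brouwer ordering *)

(** Well-foundedness of T below s in inductive form. It supplies the bar induction used for the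
    Kleene-Brouwer ordering and for the notations in O. *)
Inductive barred (T : pred nat) : nat -> Prop :=
| barred_out s : ~~ T s -> barred T s
| barred_in s : (forall k, barred T (child s k)) -> barred T s.

Lemma barred0P T : barred T 0 <-> forall f, exists k, ~~ T (initseq f k).
Proof.
split=> [b f|path].
  have gen s : barred T s -> forall k, initseq f k = s -> exists k, ~~ T
    (initseq f k).
    elim=> {}s => [Ts k E|_ IH k E]; first by exists k; rewrite E.
    by apply: (IH (f k) k.+1); rewrite /= -/(initseq f k) E.
  exact: gen b 0 erefl.
apply: contrapT => nb.
(* A node that is not barred has a child that is not barred; iterating the choice gives a path that
   never leaves T. *)
have /choice [c Hc] s : exists k, ~ barred T s -> ~ barred T (child s k).
  have [bs|nbs] := pselect (barred T s); first by exists 0.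
  have /existsNP [k Hk] : ~ forall k, barred T (child s k).
    by move=> H; apply/nbs/barred_in.
  by exists k.
pose node := nat_rec (fun _ => nat) 0 (fun _ s => child s (c s)).
pose f i := c (node i).
have Ef k : initseq f k = node k by elim: k => //= k IH; rewrite -/(initseq f k) IH.
have nbar k : ~ barred T (node k) by elim: k => [//|k IH]; apply: Hc.
have [k] := path f; rewrite Ef => /(@barred_out T).
exact: nbar.
Qed.

(* Applied to entries: the end of a sequence, coded by 0, is the largest entry. *)
Definition below (a b : nat) : bool := (0 < a) && ((b == 0) || (a < b)).

(** Extensions come first; otherwise the first difference decides. Positions up to s suffice:
    [below] forces s to have an entry there, and [len s <= s]. *)
Definition kb (s t : nat) : bool :=
  has (fun i => all (fun j => entry s j == entry t j) (iota 0 i) &&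
                below (entry s i) (entry t i)) (iota 0 s).

Lemma kbP s t : reflect
  (exists2 i, forall j, j < i -> entry s j = entry t j &
              below (entry s i) (entry t i)) (kb s t).
Proof.
apply: (iffP hasP) => [[i _ /andP [/allP H b]]|[i H b]]; exists i => //.
- by move=> j lt; apply/eqP/H; rewrite mem_iota.
- rewrite mem_iota add0n /=; apply: leq_trans (len_le s).
  by rewrite -entry_gt0; case/andP: b.
- by rewrite b andbT; apply/allP => j; rewrite mem_iota => /= lt; rewrite H.
Qed.

Lemma kb_asym s t : kb s t -> ~~ kb t s.
Proof.
move/kbP => [i Hi bi]; apply/negP => /kbP [j Hj bj].
have [lt|lt|E] := ltngtP i j.
- by move: bi; rewrite (Hj _ lt) /below; lia.
- by move: bj; rewrite (Hi _ lt) /below; lia.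
- by move: bi bj; rewrite E /below; lia.
Qed.

Lemma computableb_kb K F G : computable K F -> computable K G ->
  computableb K (fun g x => kb (F g x) (G g x)).
Proof.
move=> cF cG; rewrite /kb /below.
apply: (@computable_comp2 K (fun g s t => kb s t : nat)) => //.
rewrite /kb /below; apply: computableb_has; comp; apply: computable_entry; comp.
Qed.

Definition strict_wo (T : pred nat) (lt : rel nat) : Prop :=
  (forall x y, lt x y -> ~~ lt y x) /\
  forall A : pred nat, {subset A <= T} -> nonempty A ->
    exists2 z, z \in A & forall y, y \in A -> y != z -> lt z y.

Definition reflexive_closure (T : pred nat) (lt : rel nat) : rel nat :=
  fun x y => [&& T x, T y & (x == y) || lt x y].

Lemma strict_wo_wellorder T lt :
  strict_wo T lt -> wellorder (reflexive_closure T lt).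
Proof.
move=> [asym least]; split=> [x y /and3P [Tx Ty _]|].
  by rewrite /reflexive_closure Tx Ty !eqxx.
apply: antisymmetric_wo_chain => [x y _ _ /andP [/and3P [_ _ /orP [/eqP //|xy]]]|].
  by move=> /and3P [_ _ /orP [/eqP ->//|yx]]; have := asym _ _ xy; rewrite yx.
move=> A sA neA.
have sT : {subset A <= T} by move=> x /sA; rewrite inE => /and3P [].
have [z Az lb] := least A sT neA; exists z; split=> // y Ay.
rewrite /reflexive_closure (sT _ Az : T z) (sT _ Ay : T y) /=.
by have [<-|ne] := eqVneq y z; rewrite ?eqxx //= (lb y Ay ne).
Qed.

(** Bar induction on s, for sets A of nodes extending s. Unless A contains only s, the least node of
    A is among those that continue s by the least possible entry k, and the hypothesis at
    [child s k] finds it. *)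
Lemma barred_strict_wo (T : pred nat) :
  (forall s k, T (child s k) -> T s) -> barred T 0 -> strict_wo T kb.
Proof.
move=> closed bar; split=> [|A sAT [x Ax]]; first exact: kb_asym.
pose ext s t := forall j, j < len s -> entry t j = entry s j.
have closed_ext s t : ext s t -> T t -> T s.
  elim/seq_ind: t s => [|t k IH] s st Tt.
    suff -> : s = 0 by [].
    apply: entry_inj => i; rewrite entry0.
    case: (posnP (entry s i)) => //; rewrite entry_gt0 => lt.
    by rewrite -(st i lt) entry0 .
  have [lt|le] := ltnP (len t) (len s); last first.
    apply: IH (closed _ _ Tt) => j ltj.
    by have := st j ltj; rewrite entry_child; case: eqP => //; lia.
  suff -> : s = child t k by [].
  apply: entry_inj => i; case: (ltnP i (len s)) => lti; first by rewrite st.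
  have -> : entry s i = 0 by apply/eqP; rewrite -leqn0 leqNgt entry_gt0 -leqNgt.
  by rewrite entry_child; case: eqP => [|_]; [lia|]; rewrite /entry; case: ltnP;
    lia.
have gen s : barred T s -> forall A : pred nat, {subset A <= T} ->
    (forall t, t \in A -> ext s t) -> nonempty A ->
    exists2 z, z \in A & forall y, y \in A -> y != z -> kb z y.
  elim=> {}s => [nTs|_ IH] {sAT Ax x}A sAT sA [x Ax].
    by case/negP: nTs; apply: closed_ext (sA _ Ax) (sAT _ Ax).
  have ext_child t : t \in A -> t != s -> ext (child s (entry t (len s)).-1) t
      /\ 0 < entry t (len s).
    move=> At ne; have pos : 0 < entry t (len s).
      rewrite lt0n; apply: contra_neq ne => E0; apply: entry_inj => i.
      case: (ltnP i (len s)) => lt; first exact: sA.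
      have le : len t <= len s by rewrite leqNgt -entry_gt0 E0.
      have zero u : len u <= i -> entry u i = 0.
        by move=> leu; apply/eqP; rewrite -leqn0 leqNgt entry_gt0 -leqNgt.
      by rewrite !zero //; apply: leq_trans lt.
    split=> // j; rewrite len_child ltnS entry_child => le.
    by case: eqP => [->|ne']; [rewrite prednK|apply: sA => //; lia].
  pose B k := [pred t | (t \in A) && (entry t (len s) == k.+1)].
  have [[k0 [t0 B0]]|none] := pselect (exists k, nonempty (B k)); last first.
    have only t : t \in A -> t = s.
      move=> At; have [//|ne] := eqVneq t s; case: none.
      exists (entry t (len s)).-1, t; rewrite !inE At /=.
      by have [_ pos] := ext_child _ At ne; rewrite prednK.
    by exists x => // y /only ->; rewrite (only _ Ax) eqxx.
  have exk : exists k, `[< nonempty (B k) >] by exists k0; apply/asboolP; exists t0.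
  case: (ex_minnP exk) => k /asboolP neB mink.
  have [||z] := IH k (B k) _ _ neB; rewrite ?inE.
  - by move=> t; rewrite inE => /andP [/sAT].
  - move=> t; rewrite inE => /andP [At /eqP Ek].
    have ne : t != s.
      by apply: contra_eq_neq Ek => ->; rewrite /entry ltnn.
    by have [] := ext_child _ At ne; rewrite Ek.
  move=> /andP [Az /eqP Ez] lb; exists z => // y Ay ne.
  have [E|ns] := eqVneq y s.
    apply/kbP; exists (len s) => [j lt|]; first by rewrite (sA _ Az) // (sA _ Ay).
    by rewrite Ez E /below /entry ltnn.
  have [_ pos] := ext_child _ Ay ns.
  have [E|nE] := eqVneq (entry y (len s)) k.+1.
    by apply: lb => //; rewrite inE Ay E eqxx.
  apply/kbP; exists (len s) => [j lt|]; first by rewrite (sA _ Az) // (sA _ Ay).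
  have := mink (entry y (len s)).-1; rewrite Ez /below.
  have h : `[< nonempty (B (entry y (len s)).-1) >].
    by apply/asboolP; exists y; rewrite inE Ay prednK //=.
  by move=> /(_ h); lia.
by apply: (gen 0 bar A sAT) => //; exists x.
Qed.

(** * The tree of a Pi^1_1 predicate *)

(** A finite approximation of [fjoin g f]. Entries are shifted by one and 0 past the end, which is
    exactly the machine's convention for partial oracles. *)
Definition seq_oracle (g : nat -> nat) (s k : nat) : nat :=
  if odd k then entry s k./2 else (g k./2).+1.

(** A node survives while the computation that knows only s has not halted in [len s] steps, so the
    infinite paths are the f at which the computation with oracle [fjoin g f] diverges. *)
Definition tree (e : nat) (g : nat -> nat) (n s : nat) : bool :=
  ~~ halted (run (seq_oracle g s) e n (len s)).

Lemma step_monotone q q' st : (forall k, q k != 0 -> q' k = q k) ->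
  step q st = Stuck \/ step q' st = step q st.
Proof.
move=> qq'; rewrite /step; case: ifP => _; last by right.
rewrite /ev_step; do 4 (case: ifP => _; first by right).
case: ifP => _; last by right.
case: eqP => [_|ne]; first by left.
by rewrite (qq' (pr2 (pr1 (pr2 st)))); [right; case: eqP ne|apply/eqP].
Qed.

(** An unanswered query leads to [Stuck], which never halts; a halted run has thus met only answered
    queries, and further answers do not affect it. *)
Lemma run_monotone q q' e x s : (forall k, q k != 0 -> q' k = q k) ->
  halted (run q e x s) -> run q' e x s = run q e x s.
Proof.
move=> qq'; suff : run q e x s = Stuck \/ run q' e x s = run q e x s.
  by case=> // -> /haltedE /Stuck_neq_Rt.
elim: s => [|s IH]; [by right|rewrite /run !iterS -!/(run _ _ _ _)].
case: IH => [->|->]; last exact: step_monotone.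
by left; apply: (@iter_step_Stuck q 1).
Qed.

Lemma run_stable q e x s s' : s <= s' ->
  halted (run q e x s) -> run q e x s' = run q e x s.
Proof.
move=> le /haltedE E; rewrite -(subnK le) /run iterD -/(run q e x s) E.
exact: iter_step_Rt0.
Qed.

Lemma run_use q e x s : exists K, forall q', (forall k, k < K -> q' k = q k) ->
  run q' e x s = run q e x s.
Proof.
elim: s => [|s [K HK]]; first by exists 0.
(* The added bound covers the only query that the current state could make, the argument of the
   index being evaluated. *)
exists (maxn K (pr2 (pr1 (pr2 (run q e x s)))).+1) => q' qq'.
rewrite /run !iterS -!/(run _ _ _ _) HK => [|k lt]; last by apply: qq'; lia.
set st := run q e x s in qq' *.
by rewrite /step /ev_step qq' // leq_max ltnSn orbT.
Qed.

Lemma tree_closed e g n s k : tree e g n (child s k) -> tree e g n s.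
Proof.
apply: contra => hs.
have E : run (seq_oracle g (child s k)) e n (len s) = run (seq_oracle g s) e n
  (len s).
  apply: run_monotone => // j; rewrite /seq_oracle; case: odd => //.
  by rewrite -lt0n entry_gt0 => lt; rewrite entry_child; case: eqP => //; lia.
rewrite len_child; suff -> : run (seq_oracle g (child s k)) e n (len s).+1
    = run (seq_oracle g s) e n (len s) by [].
by rewrite -E; apply: run_stable => //; rewrite E.
Qed.

Lemma treeP e g n :
  (forall f, exists y, eval (fjoin g f) e n y) <-> barred (tree e g n) 0.
Proof.
rewrite barred0P; split=> H f.
  have [y /eval_run [s hs _]] := H f.
  have [K HK] := run_use (succn \o fjoin g f) e n s.
  (* Long enough both for the s steps and for all queries below K. *)
  exists (maxn s K); rewrite /tree negbK len_initseq.
  have E : run (seq_oracle g (initseq f (maxn s K))) e n s =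
           run (succn \o fjoin g f) e n s.
    apply: HK => k lt; rewrite /seq_oracle /fjoin /=; case: odd => //.
    rewrite entry_initseq; case: ltnP => //; have := odd_double_half k; lia.
  by rewrite (@run_stable _ _ _ s) ?E // leq_maxl.
have [k] := H f; rewrite /tree negbK => hs.
set q := seq_oracle _ _ in hs; set s := len _ in hs.
exists (result (run q e n s)); apply/eval_run; exists s.
  rewrite (@run_monotone q) // => j; rewrite /q /seq_oracle /fjoin /=.
  by case: odd => //; rewrite entry_initseq; case: ltnP.
rewrite (@run_monotone q) // => j; rewrite /q /seq_oracle /fjoin /=.
by case: odd => //; rewrite entry_initseq; case: ltnP.
Qed.

Lemma Pi_index P : Pi P -> exists e, forall g n,
  P g n <-> forall f, exists y, eval (fjoin g f) e n y.
Proof.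
move=> [D cD HD]; have [e He] := search cD; exists e => g n; rewrite HD.
split=> H f; have [s Hs] := H f; have [H1 H2] := He (fjoin g f) I n.
  by apply: H2; exists s.
by have [t Ht _] := H1 _ Hs; exists t.
Qed.

Lemma computableb_tree K (q : (nat -> nat) -> nat -> nat -> nat) E N S :
  computable K (fun g z => q g (pr1 z) (pr2 z)) ->
  computable K E -> computable K N -> computable K S ->
  computableb K (fun g x => tree (E g x) (q g x) (N g x) (S g x)).
Proof.
move=> cq cE cN cS; rewrite /tree.
apply/computableb_not/computable_halted.
apply: (@computable_run K (fun g x k => seq_oracle (q g x) (S g x) k)) => //.
  have cS' : computable K (fun g z => S g (pr1 z)) by apply: computable_comp; comp.
  rewrite /seq_oracle; comp; first by apply: computable_entry; comp.
  by apply: (computable_comp2 (H := q)); comp.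
exact: computable_len.
Qed.

(** * Completeness of Kleene's O *)

Fixpoint const_index (c : nat) : nat :=
  if c is c'.+1 then ⟨6, ⟨⟨1, 0⟩, const_index c'⟩⟩ else ⟨0, 0⟩.

(** An explicit s-m-n function, computable in c: p is composed with the pairing of the constant c
    and the identity. *)
Definition curry_index (p c : nat) : nat :=
  ⟨6, ⟨p, ⟨5, ⟨const_index c, ⟨5, ⟨⟨2, 0⟩, ⟨3, 0⟩⟩⟩⟩⟩⟩⟩.

Lemma eval_const_index g c x : eval g (const_index c) x c.
Proof.
elim: c => [|c IH] /=; first by constructor.
by apply: eval_comp IH _; constructor.
Qed.

Lemma eval_curry_index g p c k y :
  eval g (curry_index p c) k y <-> eval g p ⟨c, k⟩ y.
Proof.
have arg : eval g ⟨5, ⟨const_index c, ⟨5, ⟨⟨2, 0⟩, ⟨3, 0⟩⟩⟩⟩⟩ k ⟨c, k⟩.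
  apply: eval_pair (eval_const_index _ _ _) _.
  by rewrite -{2}(prK k); apply: eval_pair; rewrite -{1}(prK k); constructor.
split=> [/eval_comp_inv [z Hz]|]; last exact: eval_comp arg.
by rewrite (eval_det Hz arg).
Qed.

Lemma computable_const_index K F :
  computable K F -> computable K (fun g x => const_index (F g x)).
Proof.
move=> cF; apply: (@computable_ext _ (fun g x => nat_rec (fun _ => nat) ⟨0, 0⟩
    (fun _ y => ⟨6, ⟨⟨1, 0⟩, y⟩⟩) (F g x))).
  by move=> g x _; elim: (F g x) => //= n ->.
by apply: (@computable_rec K _ F (fun _ _ _ y => ⟨6, ⟨⟨1, 0⟩, y⟩⟩)); comp.
Qed.

Lemma computable_curry_index K p F :
  computable K F -> computable K (fun g x => curry_index p (F g x)).
Proof.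
by move=> /computable_const_index cF; rewrite /curry_index; comp.
Qed.

Lemma limit_code_inj e e' : 3 * 5 ^ e = 3 * 5 ^ e' -> e = e'.
Proof. by move/eqP; rewrite eqn_pmul2l // => /eqP /expnI; apply. Qed.

Lemma limit_code_neq_succ e a : 3 * 5 ^ e <> 2 ^ a.
Proof.
move=> E; have : 3 %| 2 ^ a by rewrite -E dvdn_mulr.
by rewrite Euclid_dvdX.
Qed.

Lemma limit_code_neq1 e : 3 * 5 ^ e <> 1.
Proof. by move=> E; apply: (@limit_code_neq_succ e 0). Qed.

(* The notation [tower s a] lies above a.  It is built by recursion on the
   tree below s: stack the towers of the children of s on top of one another,
   starting from a, and take the limit.  This makes addition of notations
   unnecessary.  Self-reference is obtained by passing the index [D] of the
   construction to itself. *)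
Lemma tower_exists e : exists D p, forall g n,
  let code s a := curry_index p ⟨D, ⟨n, ⟨s, a⟩⟩⟩ in
  let tower s a := if tree e g n s then 3 * 5 ^ code s a else 2 ^ a in
  forall s a k, eval g (code s a) k
    (nat_rec (fun _ => nat) a (fun j y => tower (child s j) y) k).
Proof.
pose idg (g : nat -> nat) (_ : nat) := g.
have [|u Hu] := @universal (fun _ => True) idg.
  by rewrite /idg; comp.
have [a0 Ha0] : recursive (fun _ z => pr2 (pr2 (pr2 z))) by comp.
(* Here c is [⟨D, ⟨n, ⟨s, a⟩⟩⟩], and the step runs D on the child j and the notation y reached so
   far. The leading 0 is a dummy parameter for [universal]. *)
have [b0 Hb0] : recursive (fun _ z => let c := pr1 z in let j := pr1 (pr2 z) in
    let y := pr2 (pr2 z) in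
    ⟨0, ⟨pr1 c, ⟨pr1 c, ⟨pr1 (pr2 c), ⟨child (pr1 (pr2 (pr2 c))) j, y⟩⟩⟩⟩⟩).
  by rewrite /=; comp; apply: computable_child; comp.
pose p := ⟨7, ⟨a0, ⟨6, ⟨u, b0⟩⟩⟩⟩.
(* D only writes down the limit code and never runs it, so it is total even when the tree is ill
   founded. *)
have [D HD] : recursive (fun g z =>
    if tree e g (pr1 (pr2 z)) (pr1 (pr2 (pr2 z))) then 3 * 5 ^ curry_index p z
    else 2 ^ pr2 (pr2 (pr2 z))).
  comp; last by apply: computable_curry_index; comp.
  by apply: (@computableb_tree _ (fun g _ => g)); comp.
exists D, p => g n code tower s a k; apply/eval_curry_index.
elim: k => [|k IH] /=.
  by apply: eval_prec0; have := Ha0 g I ⟨D, ⟨n, ⟨s, a⟩⟩⟩; rewrite !npairK.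
apply: eval_precS IH _; set y := nat_rec _ _ _ _.
have := Hb0 g I ⟨⟨D, ⟨n, ⟨s, a⟩⟩⟩, ⟨k, y⟩⟩; rewrite /= !npairK => Hb.
apply: eval_comp Hb _; apply/(Hu g I 0).
by have := HD g I ⟨D, ⟨n, ⟨child s k, y⟩⟩⟩; rewrite !npairK.
Qed.

Theorem KleeneO_complete P : Pi P ->
  exists2 r, recursive (fun _ n => r n) & forall g n, P g n <-> inO g (r n).
Proof.
case/Pi_index => e He; have [D [p H]] := tower_exists e.
(* Whether the root lies in the tree depends on g, but r may not; so the root always gets its limit
   code. If it is outside, so are its children, and the stack merely iterates successors. *)
exists (fun n => 3 * 5 ^ curry_index p ⟨D, ⟨n, ⟨0, 1⟩⟩⟩).
  by comp; apply: computable_curry_index; comp.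
move=> g n; rewrite He treeP; have {}H := H g n.
set code := fun s a => curry_index p ⟨D, ⟨n, ⟨s, a⟩⟩⟩ in H.
set tower := fun s a => if tree e g n s then 3 * 5 ^ code s a else 2 ^ a in H.
rewrite -/(code 0 1); set T := tree e g n in tower H *.
pose stack s a k := nat_rec (fun _ => nat) a (fun j y => tower (child s j) y) k.
have {}H s a k : eval g (code s a) k (stack s a k) by exact: H.
have limit s a : inO g a -> (forall k b, inO g b ->
      inO g (tower (child s k) b) /\ ltO g b (tower (child s k) b)) ->
    inO g (3 * 5 ^ code s a) /\ ltO g a (3 * 5 ^ code s a).
  move=> Oa IH.
  have Os k : inO g (stack s a k) by elim: k => //= k /(IH k) [].
  have lts k : ltO g (stack s a k) (stack s a k.+1) by have [] := IH k _ (Os k).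
  split; first exact: inO_lim (H s a) Os lts.
  exact: (@ltO_lim g _ (stack s a) 0 (H s a) Os lts).
have fwd s : barred T s -> forall a, inO g a ->
    inO g (tower s a) /\ ltO g a (tower s a).
  elim=> {}s => [nTs|_ IH] a Oa.
    by rewrite /tower -/T (negbTE nTs); split; constructor.
  rewrite /tower; case: ifP => _; last by split; constructor.
  by apply: limit => // k b; apply: IH.
split=> [b0|].
  have bk k : barred T (child 0 k).
    case: b0 => s; last exact.
    by move=> nT; apply: barred_out; apply: contra nT; apply: tree_closed.
  have [] := @limit 0 1 (inO_zero _) => // k b; apply: fwd; exact: bk.
(* Induction on the notation: term k+1 of the fundamental sequence is the tower of the child k, a
   limit code whenever that child is in the tree. *)
suff gen c : inO g c -> forall s a, 3 * 5 ^ code s a = c -> barred T s.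
  by move=> Oc; exact: gen Oc _ _ erefl.
elim=> {c} [|c _ _|e' f He' _ IH _] s a.
- by move/limit_code_neq1.
- by move/limit_code_neq_succ.
move=> /limit_code_inj Ec; apply: barred_in => k.
have [Tk|] := boolP (T (child s k)); last exact: barred_out.
apply: (IH k.+1 _ (stack s a k)).
have -> : f k.+1 = stack s a k.+1 by apply: eval_det (H s a k.+1); rewrite Ec.
by rewrite /= /tower -/T Tk.
Qed.

(** * Kleene's O is Pi^1_1 *)

Scheme inO_mut := Induction for inO Sort Prop
  with ltO_mut := Induction for ltO Sort Prop.
Combined Scheme inO_ltO_ind from inO_mut, ltO_mut.

(* Z codes a set U = { a | Z ⟨0, a⟩ = 0 } and a relation
   L = { (a, b) | Z ⟨1, ⟨a, b⟩⟩ = 0 } *)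
Definition O_closed (g Z : nat -> nat) : Prop :=
  Z ⟨0, 1⟩ = 0 /\
  (forall a, Z ⟨0, a⟩ = 0 -> Z ⟨0, 2 ^ a⟩ = 0 /\ Z ⟨1, ⟨a, 2 ^ a⟩⟩ = 0) /\
  (forall e, (forall n, exists y, (eval g e n y /\ Z ⟨0, y⟩ = 0) /\
          exists y', eval g e n.+1 y' /\ Z ⟨1, ⟨y, y'⟩⟩ = 0) ->
        Z ⟨0, 3 * 5 ^ e⟩ = 0 /\
        forall n y, eval g e n y -> Z ⟨1, ⟨y, 3 * 5 ^ e⟩⟩ = 0) /\
  (forall a b c, Z ⟨1, ⟨a, b⟩⟩ = 0 -> Z ⟨1, ⟨b, c⟩⟩ = 0 -> Z ⟨1, ⟨a, c⟩⟩ = 0).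

(** O is the least solution of its clauses. These are arithmetical in g and Z, because fundamental
    sequences enter through the values of [eval] and not as quantified functions. *)
Lemma inO_closedP g a : inO g a <-> forall Z, O_closed g Z -> Z ⟨0, a⟩ = 0.
Proof.
split=> [Oa Z [Z1 [Zs [Zl Zt]]]|H].
  have lim e f : (forall n, eval g e n (f n)) -> (forall n, Z ⟨0, f n⟩ = 0) ->
      (forall n, Z ⟨1, ⟨f n, f n.+1⟩⟩ = 0) ->
      Z ⟨0, 3 * 5 ^ e⟩ = 0 /\ forall n y, eval g e n y -> Z ⟨1, ⟨y, 3 * 5 ^ e⟩⟩ = 0.
    by move=> Hf Uf Lf; apply: Zl => n; exists (f n); split=> //; exists (f n.+1).
  suff [U _] : (forall a, inO g a -> Z ⟨0, a⟩ = 0) /\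
      (forall a b, ltO g a b -> Z ⟨1, ⟨a, b⟩⟩ = 0) by exact: U.
  apply: (@inO_ltO_ind g (fun a _ => Z ⟨0, a⟩ = 0) (fun a b _ =>
    Z ⟨1, ⟨a, b⟩⟩ = 0)).
  - exact: Z1.
  - by move=> b _ /Zs [].
  - by move=> e f Hf _ Uf _ Lf; have [] := lim e f Hf Uf Lf.
  - by move=> b _ /Zs [].
  - by move=> e f n Hf _ Uf _ Lf; have [_] := lim e f Hf Uf Lf; apply.
  - by move=> b c d _ + _; apply: Zt.
pose Z z := if pr1 z == 0 then `[< ~ inO g (pr2 z) >] : nat
            else `[< ~ ltO g (pr1 (pr2 z)) (pr2 (pr2 z)) >].
have ZU b : Z ⟨0, b⟩ = 0 <-> inO g b.
  by rewrite /Z !npairK /=; case: asboolP => // /contrapT.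
have ZL b c : Z ⟨1, ⟨b, c⟩⟩ = 0 <-> ltO g b c.
  by rewrite /Z !npairK /=; case: asboolP => // /contrapT.
apply/ZU/H; split; last split; last split => [e Hf|b c d /ZL bc /ZL cd].
- by apply/ZU; constructor.
- by move=> b /ZU Ob; split; [apply/ZU|apply/ZL]; constructor.
- have /choice [f Ff] n := Hf n.
  have ef n : eval g e n (f n) by have [[]] := Ff n.
  have Of n : inO g (f n) by have [[_ /ZU]] := Ff n.
  have Lf n : ltO g (f n) (f n.+1).
    by have [_ [y' [Hy' /ZL]]] := Ff n; rewrite (eval_det (ef n.+1) Hy').
  split; first exact/ZU/(inO_lim ef Of Lf).
  move=> n y Hy; apply/ZL; rewrite (eval_det Hy (ef n)).
  exact: ltO_lim ef Of Lf.
- by apply/ZL; apply: ltO_trans bc cd.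
Qed.

Lemma Pi_inO : Pi inO.
Proof.
apply: Pi_iff (fun g n => iff_sym (inO_closedP g n)) _.
rewrite /O_closed; definable.
Qed.

(** * Well-orderings of sets of natural numbers *)

Section WellOrder.
Variables (R : rel nat) (woR : wellorder R).

Lemma wo_field x y : R x y -> R x x /\ R y y.
Proof. by case: woR => H _; exact: H. Qed.

Lemma wo_least (P : nat -> Prop) x0 : R x0 x0 -> P x0 ->
  exists m, [/\ R m m, P m & forall y, R y y -> P y -> R m y].
Proof.
move=> Rx0 Px0; case: woR => _ wo.
have ne : nonempty [pred x | R x x && `[< P x >]].
  by exists x0; rewrite inE Rx0; apply/asboolP.
have sub : sub_mem (mem [pred x | R x x && `[< P x >]]) (mem [pred x | R x x]).
  by move=> y; rewrite !inE => /andP [].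
have [m [[/andP [Rm /asboolP Pm] lb] _]] := wo _ sub ne.
exists m; split=> // y Ry Py; apply: lb.
by rewrite inE Ry; apply/asboolP.
Qed.

Lemma wo_anti x y : R x y -> R y x -> x = y.
Proof.
move=> xy yx; have [Rx Ry] := wo_field xy; case: woR => _ wo.
by apply: (wo_chain_antisymmetric wo); rewrite ?inE ?xy ?yx.
Qed.

Lemma wo_total x y : R x x -> R y y -> R x y \/ R y x.
Proof.
move=> Rx Ry; case: woR => _ wo.
by apply/orP; apply: (wo_chainW wo); rewrite inE.
Qed.

(** The least element of the set of x, y and z settles every case. *)
Lemma wo_trans y x z : R x y -> R y z -> R x z.
Proof.
move=> xy yz; have [Rx Ry] := wo_field xy; have [_ Rz] := wo_field yz.
have [m [_ Pm lb]] := @wo_least (fun w => [\/ w = x, w = y | w = z]) x Rx (Or31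
  _ _ erefl).
have [] : [\/ R x z, R z x | R x z].
- case: Pm lb => -> lb; first by apply: Or31; apply: lb => //; apply: Or33.
    have -> : x = y by apply: wo_anti xy _; apply: lb => //; apply: Or31.
    exact: Or31.
  have <- : y = z by apply: wo_anti yz _; apply: lb => //; apply: Or32.
  exact: Or31.
- by [].
- move=> zx; case: Pm lb => -> lb.
  + by apply: lb => //; apply: Or33.
  + have -> : x = y by apply: wo_anti xy _; apply: lb => //; apply: Or31.
    by [].
  + have <- : y = z by apply: wo_anti yz _; apply: lb => //; apply: Or32.
    by [].
- by [].
Qed.

Lemma wo_not_le x y : R x x -> R y y -> ~ R x y -> R y x /\ y != x.
Proof.
move=> Rx Ry nxy; have [//|yx] := wo_total Rx Ry; split=> //.
by apply: contra_notN nxy => /eqP <-.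
Qed.

Lemma wo_ind (P : nat -> Prop) :
  (forall x, R x x -> (forall y, R y x -> y != x -> P y) -> P x) ->
  forall x, R x x -> P x.
Proof.
move=> IH x Rx; apply: contrapT => nPx.
have [m [Rm nPm lb]] := wo_least (P := fun x => ~ P x) Rx nPx; apply: nPm;
  apply: IH => // y ym ne.
apply: contrapT => nPy; have [Ry _] := wo_field ym.
by move/eqP: ne; apply; apply: wo_anti ym _; apply: lb.
Qed.

Lemma wo_increasing_ge f : (forall x, R x x -> R (f x) (f x)) ->
  (forall x y, R x y -> x != y -> R (f x) (f y) /\ f x != f y) ->
  forall x, R x x -> R x (f x).
Proof.
move=> fR incr; apply: wo_ind => x Rx IH; apply: contrapT => nxf.
have [fx ne] := wo_not_le Rx (fR _ Rx) nxf.
have [ff ne'] := incr _ _ fx ne.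
by case/eqP: ne'; apply: wo_anti ff (IH _ fx ne).
Qed.

Lemma init_segment_le u v x y : R u v ->
  init_segment (init_segment R v) u x y = (u != v) && init_segment R u x y.
Proof.
move=> uv; rewrite /init_segment /=.
have [Ru _] := wo_field uv; rewrite uv /=.
case xy: (R x y) => /=; last by rewrite andbF.
case yu: (R y u) => /=; last by rewrite !andbF.
have [->|ne] := eqVneq y u; first by rewrite !andbF.
rewrite (wo_trans yu uv) /=.
have [E|ne'] := eqVneq u v; first by rewrite !andbF.
suff -> : y != v by [].
by apply/eqP => E; case/eqP: ne; apply: wo_anti yu _; rewrite E.
Qed.

Lemma init_segment_wo v : wellorder (init_segment R v).
Proof.
split=> [x y /and3P [xy yv ne]|].
  have [Rx Ry] := wo_field xy; rewrite /init_segment /= Rx Ry yv ne /=.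
  rewrite (wo_trans xy yv); split=> //.
  by apply/eqP => E; case/eqP: ne; apply: wo_anti yv _; rewrite -E.
apply: antisymmetric_wo_chain => [x y _ _ /andP [/and3P [xy _ _] /and3P [yx _ _]]|].
  exact: wo_anti xy yx.
move=> A sA [x0 Ax0].
have field x : x \in A -> [/\ R x x, R x v & x != v].
  by move=> /sA; rewrite inE => /and3P.
have [Rx0 _ _] := field _ Ax0.
have [m [Rm Am lb]] := wo_least (P := fun x => x \in A) Rx0 Ax0.
exists m; split=> // y Ay; have [Ry yv ne] := field _ Ay.
by rewrite /init_segment /= lb ?yv ?ne.
Qed.

End WellOrder.

(** * Isomorphisms and comparability of well-orderings *)

(** Written with number quantifiers and an explicit f, the form that [definable] can process. *)
Definition isomorphism (R S : rel nat) (f : nat -> nat) : Prop :=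
  (forall x, R x x -> S (f x) (f x)) /\
  (forall x y, R x x -> R y y -> f x = f y -> x = y) /\
  (forall y, S y y -> exists x, R x x /\ f x = y) /\
  (forall x y, R x x -> R y y -> (R x y <-> S (f x) (f y))).

Lemma order_isoP R S : order_iso R S <-> exists f, isomorphism R S f.
Proof.
split=> [[f [fun_f inj surj] mono]|[f [f1 [inj [surj mono]]]]]; exists f.
- split; first by move=> x; apply: fun_f.
  split; first by move=> x y Rx Ry; apply: inj; rewrite inE.
  split=> [y Sy|x y Rx Ry]; last by rewrite mono.
  by have [x] := surj y Sy; exists x.
- split=> [x|x y|y /surj [x [Rx E]]]; first exact: f1; last by exists x.
  by rewrite !inE => Rx Ry; apply: inj.
- by move=> x y Rx Ry; apply/idP/idP; apply mono.
Qed.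

Lemma order_iso_refl R : order_iso R R.
Proof. by apply/order_isoP; exists id; do !split=> //; move=> y; exists y. Qed.

Lemma order_iso_trans R S T : order_iso R S -> order_iso S T -> order_iso R T.
Proof.
move=> /order_isoP [f [f1 [f2 [f3 f4]]]] /order_isoP [g [g1 [g2 [g3 g4]]]].
apply/order_isoP; exists (g \o f); split; first by move=> x /f1 /g1.
split; first by move=> x y Rx Ry /(g2 _ _ (f1 _ Rx) (f1 _ Ry)); apply: f2.
split; first by move=> z /g3 [y [/f3 [x [Rx <-]] <-]]; exists x.
by move=> x y Rx Ry; rewrite f4 // g4 //; apply: f1.
Qed.

Lemma iso_init_segment R S f v : isomorphism R S f -> R v v ->
  order_iso (init_segment R v) (init_segment S (f v)).
Proof.
move=> [f1 [f2 [f3 f4]]] Rv; apply/order_isoP; exists f.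
have field x : init_segment R v x x <-> [/\ R x x, R x v & x != v].
  by split=> /and3P.
have E x : R x x -> (x != v) = (f x != f v).
  by move=> Rx; apply/idP/idP; apply: contra_neq; [apply: f2|move->].
split; first by move=> x /and3P [Rx /(f4 _ _ Rx Rv) xv]; rewrite E // => ne;
  apply/and3P; split=> //; apply: f1.
split; first by move=> x y /and3P [Rx _ _] /and3P [Ry _ _]; apply: f2.
split.
  move=> y /and3P [/f3 [x [Rx <-]] /(f4 _ _ Rx Rv) xv]; rewrite -E // => ne.
  by exists x; split=> //; apply/and3P.
move=> x y /and3P [Rx xv nx] /and3P [Ry yv ny].
split=> /and3P [xy _ _]; apply/and3P; split=> //.
- exact/f4.
- exact/f4.
- by rewrite -E.
- exact/f4.
Qed.

Lemma order_iso_sym R S : order_iso R S -> order_iso S R.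
Proof.
move=> /order_isoP [f [f1 [f2 [f3 f4]]]].
have /choice [g Hg] y : exists x, S y y -> R x x /\ f x = y.
  by case: (boolP (S y y)) => [/f3 [x]|]; [exists x|exists 0].
apply/order_isoP; exists g; split; first by move=> y /Hg [].
split; first by move=> y y' /Hg [_ {2}<-] /Hg [_ {2}<-] ->.
split; first by move=> x Rx; exists (f x); have [Rg Eg] := Hg _ (f1 _ Rx);
  split; [exact: f1|apply: f2].
by move=> y y' /Hg [Rg Eg] /Hg [Rg' Eg']; rewrite f4 // Eg Eg'.
Qed.

(** Respecting the orders in both directions makes M functional and injective by antisymmetry, so a
    choice of values is an isomorphism. *)
Lemma matching_iso (R S : rel nat) (M : nat -> nat -> Prop) :
  (forall x, R x x -> exists y, S y y /\ M x y) ->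
  (forall y, S y y -> exists x, R x x /\ M x y) ->
  (forall x y x' y', R x x -> S y y -> R x' x' -> S y' y' ->
     M x y -> M x' y' -> (R x x' <-> S y y')) ->
  wellorder R -> wellorder S -> order_iso R S.
Proof.
move=> tot surj mono woR woS; have /choice [f Hf] x : exists y, R x x -> S y y
  /\ M x y.
  by case: (boolP (R x x)) => [/tot [y]|]; [exists y|exists 0].
apply/order_isoP; exists f; split; first by move=> x /Hf [].
split; first move=> x x' Rx Rx' E.
  have [Sy My] := Hf _ Rx; have [Sy' My'] := Hf _ Rx'.
  apply: (wo_anti woR); first by apply/(mono _ _ _ _ Rx Sy Rx' Sy' My My');
    rewrite -E.
  by apply/(mono _ _ _ _ Rx' Sy' Rx Sy My' My); rewrite -E.
split=> [y Sy|x x' Rx Rx']; last first.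
  by have [Sy My] := Hf _ Rx; have [Sy' My'] := Hf _ Rx'; apply: mono.
have [x [Rx M1]] := surj y Sy; have [Sf M2] := Hf _ Rx; exists x; split=> //.
apply: (wo_anti woS).
  by apply/(mono _ _ _ _ Rx Sf Rx Sy M2 M1).
by apply/(mono _ _ _ _ Rx Sy Rx Sf M1 M2).
Qed.

(** Such an isomorphism would be a strictly increasing map of the segment below x' into itself that
    sends x below x. *)
Lemma init_segment_not_iso R x x' : wellorder R -> R x x' -> x != x' ->
  ~ order_iso (init_segment R x') (init_segment R x).
Proof.
move=> woR xx' ne /order_isoP [f [f1 [f2 [f3 f4]]]].
have woI := init_segment_wo woR x'.
have [Rx Rx'] := wo_field woR xx'.
have field y : init_segment R x y y -> R y x /\ y != x by case/and3P.
have Ix : init_segment R x' x x by apply/and3P.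
have up y : R y x -> y != x -> init_segment R x' y y.
  move=> yx ne'; have [Ry _] := wo_field woR yx; apply/and3P; split=> //.
    exact: wo_trans yx xx'.
  by apply/eqP => E; case/eqP: ne; apply: wo_anti xx' _; rewrite -?E.
have fI y : init_segment R x' y y -> init_segment R x' (f y) (f y).
  by move/f1/field => [fy nfy]; apply: up.
have incr y z : init_segment R x' y z -> y != z ->
    init_segment R x' (f y) (f z) /\ f y != f z.
  move=> yz neyz; have [Iy Iz] := wo_field woI yz.
  split; last by apply: contra_neq neyz; apply: f2.
  have /and3P [fyz _ _] := (f4 _ _ Iy Iz).1 yz.
  by have /and3P [_ fz nz] := fI _ Iz; apply/and3P.
have /and3P [xf _ _] := wo_increasing_ge woI fI incr Ix.
have [fx nfx] := field _ (f1 _ Ix).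
by case/eqP: nfx; apply: wo_anti fx xf.
Qed.

Lemma init_segment_init R u v : wellorder R -> R u v -> u != v ->
  init_segment (init_segment R v) u = init_segment R u.
Proof.
move=> woR uv ne; apply/funext => a; apply/funext => b.
by rewrite init_segment_le // ne.
Qed.

Lemma iso_init_segment_lt R S x y x0 : wellorder R -> wellorder S ->
  order_iso (init_segment R x) (init_segment S y) -> R x0 x -> x0 != x ->
  exists y0, [/\ S y0 y, y0 != y &
    order_iso (init_segment R x0) (init_segment S y0)].
Proof.
move=> woR woS /order_isoP [f fiso] x0x ne.
have Ix0 : init_segment R x x0 x0.
  by have [Rx0 _] := wo_field woR x0x; apply/and3P.
have /and3P [_ fy nfy] := fiso.1 _ Ix0; exists (f x0); split=> //.
by have := iso_init_segment fiso Ix0; rewrite !init_segment_init.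
Qed.

Lemma iso_init_segment_mono R S x y x' y' : wellorder R -> wellorder S ->
  R x x -> S y y -> R x' x' -> S y' y' ->
  order_iso (init_segment R x) (init_segment S y) ->
  order_iso (init_segment R x') (init_segment S y') -> R x x' -> S y y'.
Proof.
move=> woR woS Rx Sy Rx' Sy' M M' xx'; apply: contrapT.
move=> /(wo_not_le woS Sy Sy') [y'y ne].
have [x0 [x0x ne0 M0]] := iso_init_segment_lt woS woR (order_iso_sym M) y'y ne.
apply: (@init_segment_not_iso R x0 x') => //.
- exact: wo_trans x0x xx'.
- by apply/eqP => E; case/eqP: ne0; apply: wo_anti x0x _; rewrite ?E.
- exact: order_iso_trans M' M0.
Qed.

(** The matched elements are closed downwards, hence are those below the least unmatched element
    v. *)
Lemma matched_segment R S : wellorder R -> wellorder S ->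
  let M x y := order_iso (init_segment R x) (init_segment S y) in
  ~ (forall x, R x x -> exists y, S y y /\ M x y) ->
  exists v, R v v /\ forall x, init_segment R v x x <->
     R x x /\ exists y, S y y /\ M x y.
Proof.
move=> woR woS M /existsNP [x0 /not_implyP [Rx0 nx0]].
have [v [Rv nv lb]] :=
  wo_least woR (P := fun x => ~ exists y, S y y /\ M x y) Rx0 nx0.
exists v; split=> // x; split=> [/and3P [Rx xv ne]|[Rx [y [Sy Mxy]]]].
  split=> //; apply: contrapT => nx; case/eqP: ne.
  by apply: (wo_anti woR) xv _; apply: lb.
have nvx : ~ R v x.
  move=> vx; have [E|ne] := eqVneq v x; first by case: nv; rewrite E; exists y.
  have [y0 [y0y _ Mv]] := iso_init_segment_lt woR woS Mxy vx ne.
  by case: nv; exists y0; split=> //; have [] := wo_field woS y0y.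
by have [xv ne] := wo_not_le woR Rv Rx nvx; apply/and3P.
Qed.

Lemma order_iso_trichotomy R S : wellorder R -> wellorder S ->
  [\/ order_iso R S, otype_lt R S | otype_lt S R].
Proof.
move=> woR woS; pose M x y := order_iso (init_segment R x) (init_segment S y).
have symM x y : M x y <-> order_iso (init_segment S y) (init_segment R x).
  by split; apply: order_iso_sym.
have mono x y x' y' : R x x -> S y y -> R x' x' -> S y' y' ->
    M x y -> M x' y' -> (R x x' <-> S y y').
  move=> Rx Sy Rx' Sy' Mxy Mxy'; split.
    exact: (iso_init_segment_mono woR woS Rx Sy Rx' Sy').
  by apply: (iso_init_segment_mono woS woR Sy Rx Sy' Rx'); apply: order_iso_sym.
have [totR|/(matched_segment woR woS) [v [Rv Hv]]] :=
  pselect (forall x, R x x -> exists y, S y y /\ M x y).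
  have [totS|/(matched_segment woS woR) [w [Sw Hw]]] :=
    pselect (forall y, S y y -> exists x, R x x /\
               order_iso (init_segment S y) (init_segment R x)).
    apply: Or31; apply: (matching_iso (M := M)) => // y /totS.
    by move=> [x [Rx /symM]]; exists x.
  apply: Or32; exists w => //.
  apply: (matching_iso (M := M)) => //; last exact: init_segment_wo.
  - move=> x Rx; have [y [Sy Mxy]] := totR x Rx; exists y; split=> //.
    by apply/Hw; split=> //; exists x; split=> //; apply/symM.
  - by move=> y /Hw [Sy [x [Rx /symM]]]; exists x.
  - move=> x y x' y' Rx /Hw [Sy hy] Rx' /Hw [Sy' hy'] Mxy Mxy'.
    rewrite (mono _ _ _ _ Rx Sy Rx' Sy' Mxy Mxy').
    split=> [yy'|/and3P [] //].
    have /and3P [_ yw nw] := (Hw y').2 (conj Sy' hy').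
    by apply/and3P.
have [totS|/(matched_segment woS woR) [w [Sw Hw]]] :=
    pselect (forall y, S y y -> exists x, R x x /\
               order_iso (init_segment S y) (init_segment R x)).
  apply: Or33; exists v => //.
  apply: (matching_iso (M := fun y x => M x y)) => //; last exact: init_segment_wo.
  - move=> y Sy; have [x [Rx /symM Mxy]] := totS y Sy; exists x; split=> //.
    by apply/Hv; split=> //; exists y.
  - by move=> x /Hv [Rx [y]]; exists y.
  - move=> y x y' x' Sy /Hv [Rx hx] Sy' /Hv [Rx' hx'] Mxy Mxy'.
    rewrite -(mono _ _ _ _ Rx Sy Rx' Sy' Mxy Mxy').
    split=> [xx'|/and3P [] //].
    have /and3P [_ xv nv] := (Hv x').2 (conj Rx' hx').
    by apply/and3P.
(* With unmatched elements on both sides, the least ones have isomorphic segments and so match each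
   other after all. *)
have Mvw : M v w.
  apply: (matching_iso (M := M)); last 2 first.
  - exact: init_segment_wo.
  - exact: init_segment_wo.
  - move=> x /Hv [Rx [y [Sy Mxy]]]; exists y; split=> //.
    by apply/Hw; split=> //; exists x; split=> //; apply/symM.
  - move=> y /Hw [Sy [x [Rx /symM Mxy]]]; exists x; split=> //.
    by apply/Hv; split=> //; exists y.
  - move=> x y x' y' /Hv [Rx hx] /Hw [Sy hy] hx' hy' Mxy Mxy'.
    have [Rx' _] := (Hv x').1 hx'; have [Sy' _] := (Hw y').1 hy'.
    have E := mono _ _ _ _ Rx Sy Rx' Sy' Mxy Mxy'.
    case/and3P: hx' hy' => _ xv nv /and3P [_ yw nw].
    by split=> /and3P [/E h _ _]; apply/and3P.
have : init_segment R v v v by apply/Hv; split=> //; exists w.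
by case/and3P=> _ _ /eqP.
Qed.

Lemma otype_lt_trans R S T : wellorder T ->
  otype_lt R S -> otype_lt S T -> otype_lt R T.
Proof.
move=> woT [v Sv iR] [w Tw /order_isoP [f fiso]].
have /and3P [Tf fw ne] := fiso.1 _ Sv; exists (f v) => //.
apply: order_iso_trans iR _.
by have := iso_init_segment fiso Sv; rewrite (init_segment_init woT fw ne).
Qed.

Lemma otype_lt_iso_l R R' S : order_iso R R' -> otype_lt R' S -> otype_lt R S.
Proof. by move=> i [v Sv j]; exists v => //; apply: order_iso_trans i j. Qed.

Lemma otype_lt_iso_r R S S' : otype_lt R S -> order_iso S S' -> otype_lt R S'.
Proof.
move=> [v Sv i] /order_isoP [f fiso]; exists (f v); first exact: fiso.1.
exact: order_iso_trans i (iso_init_segment fiso Sv).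
Qed.

Lemma order_iso_wellorder (R S : rel nat) : wellorder R ->
  (forall x y, S x y -> S x x /\ S y y) -> order_iso R S -> wellorder S.
Proof.
move=> woR fS /order_isoP [f [f1 [f2 [f3 f4]]]]; split=> //.
apply: antisymmetric_wo_chain.
  move=> x y; rewrite !inE => Sx Sy /andP [xy yx].
  move: (f3 _ Sx) (f3 _ Sy) xy yx => [a [Ra <-]] [b [Rb <-]].
  by move=> /(f4 _ _ Ra Rb) ab /(f4 _ _ Rb Ra) ba; rewrite (wo_anti woR ab ba).
move=> A sA [y0 Ay0].
have field y : y \in A -> S y y by move/sA; rewrite inE.
have [x0 [Rx0 E0]] := f3 _ (field _ Ay0); rewrite -E0 in Ay0.
have [m [Rm Am lb]] := wo_least woR (P := fun x => f x \in A) Rx0 Ay0.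
exists (f m); split=> // y Ay; have [x [Rx E]] := f3 _ (field _ Ay).
by rewrite -E; apply/(f4 _ _ Rm Rx)/lb => //; rewrite E.
Qed.

(** * Turing reducibility *)

Notation computable_in X := (computable (fun g => g = char X)).

Lemma turing_leP X Y : X <=T Y <-> computable_in Y (fun _ n => char X n).
Proof.
split=> [[e He]|[e He]]; exists e; first by move=> g ->.
exact: He.
Qed.

Lemma recursive_computable K F : recursive F -> computable K F.
Proof. by move=> [e He]; exists e => g _; apply: He. Qed.

Lemma turing_le_trans Y X Z : X <=T Y -> Y <=T Z -> X <=T Z.
Proof.
move=> /turing_leP cX /turing_leP cY; apply/turing_leP.
apply: (@computable_subst _ _ (fun _ n => char X n) (fun _ _ n => char Y n)
  (fun _ n => n)) cX _ _ => //.
- by apply: (@computable_comp _ (fun _ n => char Y n) (fun _ z => pr2 z)); comp.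
- by comp.
Qed.

Lemma char_iff X Y n m : (X n <-> Y m) -> char X n = char Y m.
Proof. by move=> E; rewrite /char; congr nat_of_bool; apply/asbool_equiv_eq. Qed.

Lemma char_eq1 X n : char X n = 1 <-> X n.
Proof. by rewrite /char; case: asboolP. Qed.

Lemma turing_le_mreduction X Y r : recursive (fun _ n => r n) ->
  (forall n, X n <-> Y (r n)) -> X <=T Y.
Proof.
move=> cr E; apply/turing_leP.
apply: (@computable_ext _ (fun g n => g (r n))) => [g n ->|].
  by apply: char_iff; rewrite E.
by have := recursive_computable (fun g => g = char Y) cr => cr'; comp.
Qed.

Lemma tjoin_computable X Y Z : X <=T Z -> Y <=T Z -> tjoin X Y <=T Z.
Proof.
move=> /turing_leP cX /turing_leP cY; apply/turing_leP.
apply: (@computable_ext _ (fun g n => if odd n then char Y n./2 else char X n./2)).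
  by move=> g n _; case on: (odd n); apply: char_iff; rewrite /tjoin /= on.
comp.
  by apply: (@computable_comp _ (fun _ n => char Y n) (fun _ n => n./2)); comp.
by apply: (@computable_comp _ (fun _ n => char X n) (fun _ n => n./2)); comp.
Qed.

Lemma tjoin_r X Y : Y <=T tjoin X Y.
Proof.
apply: (@turing_le_mreduction _ _ (fun n => n.*2.+1)); first by comp.
by move=> n; rewrite /tjoin /= odd_double /= uphalf_double.
Qed.

(** * Indices of relations and the ordinals omega_1^X *)

Lemma graphE R x y : graph R ⟨x, y⟩ = R x y.
Proof. by rewrite /graph /= /npair Cantor.cancel_of_to. Qed.

Lemma char_graph R n : char (graph R) n = R (pr1 n) (pr2 n).
Proof.
by rewrite -{1}(prK n) /char graphE; case: (R _ _); case: asboolP.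
Qed.

Lemma graph_leP R X :
  graph R <=T X <-> exists e, total01 (char X) e /\ R = rel_index (char X) e.
Proof.
split=> [[e He]|[e [tot ->]]]; exists e.
  split=> [k|]; first by have := He k; rewrite {2}/char; case: asbool; [right|left].
  apply/funext => x; apply/funext => y; apply/idP/idP => [xy|/asboolP E].
    by apply/asboolP; have := He ⟨x, y⟩; rewrite (char_eq1 _ _).2 // graphE.
  by rewrite -graphE; apply/char_eq1; apply: eval_det (He _) E.
move=> n; rewrite -(prK n).
have [E|E] := tot ⟨pr1 n, pr2 n⟩.
  have -> // : char (graph (rel_index (char X) e)) ⟨pr1 n, pr2 n⟩ = 0.
  rewrite /char graphE; case: asboolP => // /asboolP E'.
  by have := eval_det E E'.
have -> // : char (graph (rel_index (char X) e)) ⟨pr1 n, pr2 n⟩ = 1.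
by apply/char_eq1; rewrite graphE; apply/asboolP.
Qed.

Lemma graph_le_computable R X :
  graph R <=T X <-> computable_in X (fun _ z => R (pr1 z) (pr2 z)).
Proof.
by rewrite turing_leP; split; apply: computable_ext => g n _; rewrite char_graph.
Qed.

Lemma recursive_otype_iso X R S :
  order_iso R S -> recursive_otype X S -> recursive_otype X R.
Proof. by move=> i [T [wo rT j]]; exists T; split=> //;
  apply: order_iso_trans i j. Qed.

Lemma recursive_otype_lt X R S :
  otype_lt R S -> recursive_otype X S -> recursive_otype X R.
Proof.
move=> lt [T [woT /graph_le_computable cT i]].
have [w Tw j] := otype_lt_iso_r lt i; exists (init_segment T w); split=> //.
  exact: init_segment_wo.
apply/graph_le_computable; rewrite /init_segment /=.
pose H (g : nat -> nat) x y : nat := T x y.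
comp; apply: (computable_comp2 (H := H) cT); comp.
Qed.

(** An X-recursive copy of the sum, with index e, is one of its summands. The map [phi] into that
    summand is then strictly increasing on the sum and moves the largest element 0 down. *)
Lemma not_recursive_otype_exists X : exists2 R, wellorder R & ~ recursive_otype X R.
Proof.
pose S e : rel nat := if `[< wellorder (rel_index (char X) e) >]
  then rel_index (char X) e else fun _ _ => false.
(* The sum of all X-recursive well-orderings, with 0 as a largest element *)
pose T : pred nat := fun a => if a is a'.+1 then S (pr1 a') (pr2 a') (pr2 a')
  else true.
pose lt a b := if a is a'.+1 then if b is b'.+1 then
   (pr1 a' < pr1 b') ||
   [&& pr1 a' == pr1 b', S (pr1 a') (pr2 a') (pr2 b') & pr2 a' != pr2 b']
   else true else false.
have woS e x : S e x x -> wellorder (S e).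
  by rewrite /S; case: asboolP.
have antiS e x y : S e x y -> S e y x -> x = y.
  by rewrite /S; case: asboolP => // wo; apply: wo_anti.
have swo : strict_wo T lt.
  split=> [[|a] [|b] //|A sA [a0 Aa0]]; rewrite /lt.
    move=> /orP [lab|/and3P [/eqP E Sab ne]]; first by lia.
    rewrite E ltnn eqxx /=; apply/negP => /andP [Sba _].
    by case/eqP: ne; apply: antiS Sab _; rewrite E.
  have [[b Ab]|none] := pselect (exists b, b.+1 \in A); last first.
    exists a0 => // y Ay; case: y Ay => [|y] Ay; last by case: none; exists y.
    by case: a0 Aa0 => [|a] // Aa; case: none; exists a.
  have exk : exists k, `[< exists b, b.+1 \in A /\ pr1 b = k >].
    by exists (pr1 b); apply/asboolP; exists b.
  case: (ex_minnP exk) => k /asboolP [c [Ac Ec]] mink.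
  have Sc : S k (pr2 c) (pr2 c) by rewrite -Ec; have := sA _ Ac.
  have Akc : ⟨k, pr2 c⟩.+1 \in A by rewrite -Ec prK.
  have [m [Sm Am lb]] := wo_least (woS _ _ Sc)
    (P := fun x => ⟨k, x⟩.+1 \in A) Sc Akc.
  exists ⟨k, m⟩.+1 => // -[//|y] Ay ne; rewrite !npairK.
  have ley : k <= pr1 y by apply: mink; apply/asboolP; exists y.
  have [//|ltk|E] := ltngtP k (pr1 y); first by lia.
  rewrite /= lb.
  - by apply: contra_neq ne => ->; rewrite E prK.
  - by rewrite E; have := sA _ Ay.
  - by rewrite E prK.
pose W := reflexive_closure T lt.
have woW : wellorder W by apply: strict_wo_wellorder.
exists W => // -[Q [woQ /graph_leP [e [tot EQ]] /order_isoP [f [f1 [f2 [f3 f4]]]]]].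
have SQ : S e = Q by rewrite /S -EQ; case: asboolP.
pose phi a := ⟨e, f a⟩.+1.
have phiT a : W a a -> T (phi a) by move/f1; rewrite /phi /= !npairK SQ.
have W0 : W 0 0 by [].
suff /(_ 0 W0) /and3P [_ _] : forall a, W a a -> W a (phi a) by [].
apply: (wo_increasing_ge woW).
  by move=> a Wa; rewrite /W /reflexive_closure (phiT _ Wa) eqxx.
move=> a b Wab ne; have [Wa Wb] := wo_field woW Wab.
have nf : f a != f b by apply: contra_neq ne; apply: f2.
have np : phi a != phi b.
  by apply: contra_neq nf => -[/npair_inj []].
split=> //; rewrite /W /reflexive_closure (phiT _ Wa) (phiT _ Wb) (negbTE np) /=.
by rewrite !npairK ltnn eqxx /= SQ nf andbT; apply/(f4 _ _ Wa Wb).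
Qed.

Lemma omega1_exists X : exists R, is_omega1 X R.
Proof.
have [R woR nR] := not_recursive_otype_exists X.
have [[v [Rv nv]]|none] :=
  pselect (exists v, R v v /\ ~ recursive_otype X (init_segment R v)); last first.
  exists R; split=> // S woS [v Rv i]; apply: recursive_otype_iso i _.
  by apply: contrapT => nv; apply: none; exists v.
have [m [Rm nm lb]] := wo_least woR
  (P := fun v => ~ recursive_otype X (init_segment R v)) Rv nv.
exists (init_segment R m); split=> //; first exact: init_segment_wo.
move=> S woS [w /and3P [Rw wm ne] i]; apply: recursive_otype_iso i _.
rewrite init_segment_init //; apply: contrapT => nw.
by case/eqP: ne; apply: (wo_anti woR) wm _; apply: lb.
Qed.

(** An X-recursive type is below omega_1^X, and by comparability a type without recursive copy is at
    least omega_1^CK. This replaces the two ordinals by one well-ordering. *)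
Lemma omega1_gt_CKP X : omega1_gt_CK X <->
  exists S, [/\ wellorder S, graph S <=T X & ~ recursive_otype set0 S].
Proof.
split=> [[R [S [[woR nR minR] [woS nS minS] lt]]]|[T [woT rT nT]]].
  have [T [woT rT i]] := minS R woR lt; exists T; split=> // rT0.
  by apply: nR; apply: recursive_otype_iso i rT0.
have [R [woR nR minR]] := omega1_exists set0; have [S [woS nS minS]] :=
  omega1_exists X.
exists R, S; split=> //.
have XT : recursive_otype X T by exists T; split=> //; apply: order_iso_refl.
have TS : otype_lt T S.
  have [i|//|lt] := order_iso_trichotomy woT woS.
    by case: nS; apply: recursive_otype_iso (order_iso_sym i) XT.
  by case: nS; apply: recursive_otype_lt lt XT.
have [i|lt|lt] := order_iso_trichotomy woR woT.
- exact: otype_lt_iso_l i TS.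
- exact: otype_lt_trans woS lt TS.
- by case: nT; apply: minR.
Qed.

Definition embeds (R S : rel nat) : Prop := exists f, forall x y,
  R x y -> x != y -> S (f x) (f y) /\ f x != f y.

Lemma order_iso_embeds R S : wellorder R -> order_iso R S -> embeds R S.
Proof.
move=> woR /order_isoP [f [_ [f2 [_ f4]]]]; exists f => x y xy ne.
have [Rx Ry] := wo_field woR xy; split; first exact/(f4 _ _ Rx Ry).
by apply: contra_neq ne; apply: f2.
Qed.

Lemma otype_lt_embeds R S : wellorder R -> otype_lt R S -> embeds R S.
Proof.
move=> woR [v _ /(order_iso_embeds woR) [f Hf]]; exists f => x y xy ne.
by have [/and3P [? _ _] ?] := Hf x y xy ne.
Qed.

Lemma not_recursive_otype_embeds X R S : wellorder R -> wellorder S ->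
  recursive_otype X R -> ~ recursive_otype X S -> embeds R S.
Proof.
move=> woR woS rR nS; have [i|lt|lt] := order_iso_trichotomy woR woS.
- exact: order_iso_embeds.
- exact: otype_lt_embeds.
- by case: nS; apply: recursive_otype_lt lt rR.
Qed.

(** * Definability of well-orderedness *)

Lemma char0 : char set0 = fun _ => 0.
Proof. by apply/funext => n; rewrite /char; case: asboolP. Qed.

(** Subsets appear as zero sets of functions, which leaves a single universal function
    quantifier. *)
Lemma wellorderP R : wellorder R <->
  (forall x y, R x y -> R x x /\ R y y) /\
  forall Z : nat -> nat, (forall x, Z x = 0 -> R x x) -> (exists x, Z x = 0) ->
    exists m, Z m = 0 /\ (forall y, Z y = 0 -> R m y) /\
      forall m', Z m' = 0 -> (forall y, Z y = 0 -> R m' y) -> m = m'.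
Proof.
split=> [woR|[fR wo]]; split; first exact: wo_field.
- move=> Z ZR [x Zx].
  have [m [Rm Zm lb]] := wo_least woR (P := fun x => Z x = 0) (ZR _ Zx) Zx.
  exists m; split=> //; split=> [y Zy|m' Zm' lb']; first exact: lb (ZR _ Zy) Zy.
  by apply: (wo_anti woR); [apply: lb => //; apply: ZR|apply: lb'].
- exact: fR.
- move=> A sA [x Ax]; pose Z x : nat := x \notin A.
  have ZA y : Z y = 0 <-> y \in A by rewrite /Z; case: (y \in A).
  have [y /ZA /sA|m [/ZA Am [lb uniq]]] := wo Z _ (ex_intro _ x ((ZA x).2 Ax)).
  - by rewrite inE.
  exists m; split=> [|m' [Am' lb']]; first by split=> // y /ZA; apply: lb.
  by apply: uniq; [apply/ZA|move=> y /ZA; apply: lb'].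
Qed.

Lemma Pi_wellorder (q : (nat -> nat) -> nat -> nat -> nat) E :
  recursive (fun g z => q g (pr1 z) (pr2 z)) -> recursive E ->
  Pi (fun g n => wellorder (rel_index (q g n) (E g n))).
Proof.
apply: (@Pi_subst (fun g n => wellorder (rel_index g n))).
apply: Pi_iff (fun g n => iff_sym (wellorderP _)) _.
by definable.
Qed.

(** Well-orderedness of the j-th relation would be a Pi^1_1 condition under the negation. Only its
    field condition is asked, and the isomorphism with a well-ordering gives the rest
    ([order_iso_wellorder]). *)
Definition omega1_gt_CK_rel (g : nat -> nat) : Prop :=
  exists i, total01 g i /\ wellorder (rel_index g i) /\
    forall j (f : nat -> nat), ~ (total01 (fun _ => 0) j /\
      (forall x y, rel_index (fun _ => 0) j x y ->
         rel_index (fun _ => 0) j x x /\ rel_index (fun _ => 0) j y y) /\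
      isomorphism (rel_index g i) (rel_index (fun _ => 0) j) f).

Lemma omega1_gt_CK_relP X : omega1_gt_CK X <-> omega1_gt_CK_rel (char X).
Proof.
rewrite omega1_gt_CKP /omega1_gt_CK_rel -char0;
  split=> [[S [woS rS nS]]|[i [tot [wo H]]]].
  have [i [tot ES]] := (graph_leP _ _).1 rS; subst S.
  exists i; split=> //; split=> // j f [tot0 [fld iso]]; apply: nS.
  exists (rel_index (char set0) j).
  have i1 : order_iso (rel_index (char X) i) (rel_index (char set0) j).
    by apply/order_isoP; exists f.
  by split=> //; [apply: order_iso_wellorder woS fld i1|apply/graph_leP; exists j].
exists (rel_index (char X) i); split=> //; first by apply/graph_leP; exists i.
move=> [T [woT /graph_leP [j [tot0 ET]] /order_isoP [f iso]]]; subst T.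
by apply: (H j f); split=> //; split=> // x y; apply: wo_field.
Qed.

Lemma Pi_omega1_gt_CK : Pi (fun g n => omega1_gt_CK_rel g).
Proof.
rewrite /omega1_gt_CK_rel /total01 /isomorphism; definable.
by apply: Pi_wellorder; definable_leaf.
Qed.

(** [oracle_join X f] and [fjoin (char X) f] are convertible. *)
Lemma Pi_is_Pi11 P : Pi P -> exists e, forall X n, Pi11 e X n <-> P (char X) n.
Proof. by case/Pi_index => e He; exists e => X n; rewrite He. Qed.

Lemma Vstar_index : exists e, forall X, Pi11 e X = Vstar X.
Proof.
have [|e He] := @Pi_is_Pi11 (fun g m =>
    (odd m -> omega1_gt_CK_rel g /\ inO g m./2) /\
    (~~ odd m -> exists y, eval g m./2 m./2 y)).
  definable.
  - exact: Pi_omega1_gt_CK.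
  - by apply: (@Pi_subst inO (fun g _ => g)) Pi_inO _ _; comp.
exists e => X; apply/funext => m; apply/propext; rewrite He /Vstar /=.
rewrite -omega1_gt_CK_relP; case: (odd m); split=> [[H1 H2]|H].
- exact: H1.
- by split.
- exact: H2.
- by split.
Qed.

(** * The two cases of the argument *)

(** The Sigma^1_1 certificate of well-foundedness: when S is a well-ordering, such an f bars T. *)
Definition descends (T : pred nat) (S : rel nat) (f : nat -> nat) : Prop :=
  forall s k, T (child s k) -> S (f (child s k)) (f s) /\ f (child s k) <> f s.

Lemma descends_barred T S f : wellorder S -> descends T S f -> barred T 0.
Proof.
move=> woS desc; apply/barred0P => p; apply: contrapT => /forallNP Tp.
have {}Tp k : T (initseq p k) by have /negP := Tp k; rewrite negbK.
pose u k := f (initseq p k).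
have du k : S (u k.+1) (u k) /\ u k.+1 <> u k.
  by apply: (desc (initseq p k) (p k)); apply: (Tp k.+1).
have [Su1 Su0] := wo_field woS (du 0).1.
have [m [Sm [k Ek] lb]] :=
  wo_least woS (P := fun x => exists k, u k = x) Su0 (ex_intro _ 0 erefl).
have [Sk ne] := du k; have [Sk1 _] := wo_field woS Sk.
by apply: ne; apply: (wo_anti woS) Sk _; rewrite Ek; apply: lb => //; exists k.+1.
Qed.

Lemma child_neq s k : child s k != s.
Proof. by have := npair_ge s k; rewrite /child; lia. Qed.

Lemma kb_child s k : kb (child s k) s.
Proof.
apply/kbP; exists (len s) => [j lt|].
  by rewrite entry_child; case: eqP lt => // ->; rewrite ltnn.
by rewrite entry_child eqxx /below /entry ltnn.
Qed.

Lemma barred_descends (T : pred nat) S :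
  (forall s k, T (child s k) -> T s) ->
  embeds (reflexive_closure T kb) S -> exists f, descends T S f.
Proof.
move=> closed [f Hf]; exists f => s k Ts.
have [||Sf /eqP] := Hf (child s k) s; last by [].
  by rewrite /reflexive_closure Ts (closed _ _ Ts) kb_child orbT.
exact: child_neq.
Qed.

Lemma tree_wellorder e g n : barred (tree e g n) 0 ->
  wellorder (reflexive_closure (tree e g n) kb).
Proof.
move=> b; apply/strict_wo_wellorder/barred_strict_wo => //.
by move=> s k; apply: tree_closed.
Qed.

Lemma graph_tree_le e X n : graph (reflexive_closure (tree e (char X) n) kb) <=T X.
Proof.
apply/graph_le_computable.
apply: (@computable_ext _ (fun g z => reflexive_closure (tree e g n) kb (pr1 z)
  (pr2 z))).
  by move=> g z ->.
rewrite /reflexive_closure; comp.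
- by apply: (@computableb_tree _ (fun g _ => g)); comp.
- by apply: (@computableb_tree _ (fun g _ => g)); comp.
- by apply: computableb_kb; comp.
Qed.

(** Arithmetical in g and Z with a unique solution, so the jump can be introduced by an existential
    or by a universal quantifier over Z. *)
Definition is_jump (g Z : nat -> nat) : Prop :=
  forall k, (Z k = 1 /\ exists y, eval g k k y) \/ (Z k = 0 /\ ~ exists y, eval
    g k k y).

Lemma is_jumpP X Z : is_jump (char X) Z <-> Z = char (jump X).
Proof.
split=> [H|-> k]; last first.
  by rewrite /char; case: asboolP; [left|right].
apply/funext => k; rewrite /char.
by have [[-> ?]|[-> ?]] := H k; case: asboolP.
Qed.

Lemma KleeneO_le_jump_omega1 B : KleeneO set0 <=T jump B -> omega1_gt_CK B.
Proof.
move=> [c Hc]; apply: contrapT => ngt.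
pose WO i := total01 (fun _ => 0) i /\ wellorder (rel_index (fun _ => 0) i).
have [|r cr Hr] := @KleeneO_complete (fun _ i => WO i).
  rewrite /WO /total01; definable.
  by apply: (@Pi_wellorder (fun _ _ _ => 0)); comp.
pose Univ (g : nat -> nat) (n : nat) := forall f, exists y, eval (fjoin g f) n n y.
have [|e He] := @Pi_index Univ; first by rewrite /Univ /fjoin; definable.
(* Z is the jump, the reduction c of O to the jump confirms through r that i is an index of a
   recursive well-ordering, and f descends into it. [E] is Sigma^1_1 for all oracles but is compared
   with [Univ] at [char B] alone. *)
pose E (g : nat -> nat) (n : nat) := exists Z, is_jump g Z /\
  exists i, eval Z c (r i) 1 /\
  exists f, descends (tree e g n) (rel_index (fun _ => 0) i) f.
have [|e' He'] := @Pi_index (fun g n => ~ E g n).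
  rewrite -/(Sig E) /E /is_jump /descends; definable.
  - by apply: (@computable_comp _ (fun _ n => r n) (fun _ n => pr2 n)); comp.
  - apply: (@computableb_tree _ (fun g _ k => g k.*2.*2)); comp.
    by apply: computable_child; comp.
  - by apply: computable_child; comp.
  - by apply: computable_child; comp.
have EU n : E (char B) n <-> Univ (char B) n.
  rewrite He treeP; split=> [[Z [/is_jumpP -> [i [ei [f Hf]]]]]|bar].
    have /(char_eq1 (KleeneO set0)) : char (KleeneO set0) (r i) = 1.
      exact: eval_det (Hc _) ei.
    by rewrite /KleeneO /= -Hr => -[_ wo]; apply: descends_barred wo Hf.
  exists (char (jump B)); split; first exact/is_jumpP.
  have woT := tree_wellorder bar.
  (* Otherwise the Kleene-Brouwer ordering of the tree, recursive in B, would show that omega_1^B >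
     omega_1^CK. *)
  have [S [woS /graph_leP [i [tot ES]] iso]] :
      recursive_otype set0 (reflexive_closure (tree e (char B) n) kb).
    apply: contrapT => nT; apply: ngt; apply/omega1_gt_CKP.
    by exists (reflexive_closure (tree e (char B) n) kb); split=> //;
      apply: graph_tree_le.
  exists i; rewrite ES char0 in tot woS iso *.
  split; last first.
    apply: barred_descends; first by move=> s k; apply: tree_closed.
    exact: order_iso_embeds.
  have <- : char (KleeneO set0) (r i) = 1.
    by apply/char_eq1; rewrite /KleeneO /= -Hr.
  exact: Hc.
(* The number e' indexes the complement of [E], so at e' the predicate [Univ] holds iff it fails. *)
by have := He' (char B) e'; rewrite -/(Univ _ _) EU; tauto.
Qed.

Lemma KleeneO_KleeneO_le B : omega1_gt_CK B ->
  KleeneO (KleeneO set0) <=T KleeneO B.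
Proof.
move=> /omega1_gt_CKP [S [woS /graph_leP [i [_ ES]] nS]]; subst S.
have [e He] := Pi_index Pi_inO.
pose OE (g : nat -> nat) (n : nat) :=
  exists f, descends (tree e (fun _ => 0) n) (rel_index g i) f.
have OEP n : OE (char B) n <-> inO (char set0) n.
  rewrite He treeP char0; split=> [[f]|bar]; first exact: descends_barred.
  apply: barred_descends; first by move=> s k; apply: tree_closed.
  have woT := tree_wellorder bar.
  apply: (not_recursive_otype_embeds woT woS _ nS).
  exists (reflexive_closure (tree e (fun _ => 0) n) kb); split.
  - exact: woT.
  - by rewrite -char0; apply: graph_tree_le.
  - exact: order_iso_refl.
(* The premise on Z must be Sigma^1_1: membership in O is stated by [OE], non-membership by the
   failure of [inO]. At the oracle [char B] only the characteristic function of O satisfies it. *)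
pose Q (g : nat -> nat) (n : nat) := forall Z : nat -> nat,
  (forall k, (Z k = 1 /\ OE g k) \/ (Z k = 0 /\ ~ inO (fun _ => 0) k)) -> inO Z n.
have [|r cr Hr] := @KleeneO_complete Q.
  rewrite /Q /OE /descends; definable.
  - apply: (@computableb_tree _ (fun _ _ _ => 0)); comp.
    by apply: computable_child; comp.
  - by apply: computable_child; comp.
  - by apply: computable_child; comp.
  - by apply: (@Pi_subst inO (fun _ _ _ => 0)) Pi_inO _ _; comp.
  - by apply: (@Pi_subst inO (fun h _ k => od h k)) Pi_inO _ _; rewrite ?/od; comp.
apply: (turing_le_mreduction cr) => n; rewrite -[KleeneO B _]Hr.
split=> [O Z HZ|]; last first.
  apply=> k; rewrite -char0 OEP /char.
  by case: asboolP => H; [left|right].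
suff -> : Z = char (KleeneO set0) by [].
apply/funext => k; have := HZ k; rewrite -char0 OEP /char.
by case: asboolP => H [[->]|[->]].
Qed.

(** * Jumps and the theorem *)

(** If X computed its jump, some d would converge exactly on the complement of the jump; the
    contradiction arises at d itself. *)
Lemma jump_not_le X : ~ jump X <=T X.
Proof.
move=> /turing_leP cJ.
have [|d Hd] := @search (fun g => g = char X) (fun _ z =>
  char (jump X) (pr1 z) == 0).
  apply: computableb_eqn; last by comp.
  by apply: (@computable_comp _ (fun _ n => char (jump X) n) (fun _ z => pr1 z));
    comp.
have [H1 H2] := Hd (char X) erefl d.
have [Jd|nJd] := pselect (jump X d).
  have [y /H1 [t]] := Jd; rewrite npairK1 => /eqP.
  by rewrite (char_eq1 _ _).2.
apply: (nJd); apply: H2; exists 0; rewrite npairK1.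
by rewrite /char; case: asboolP.
Qed.

(** The search condition ignores both its candidate and the input k, so [curry_index p n] converges
    everywhere if n is in X and nowhere otherwise. *)
Lemma le_jump X : X <=T jump X.
Proof.
have [|p Hp] := @search (fun _ => True) (fun g z => g (pr1 (pr1 z)) == 1).
  by comp.
apply: (@turing_le_mreduction _ _ (curry_index p)).
  by apply: (@computable_curry_index _ p (fun _ n => n)); comp.
move=> n; have [H1 H2] := Hp (char X) I ⟨n, curry_index p n⟩.
split=> [/char_eq1 Xn|[y /eval_curry_index /H1 [t]]].
  have [|y Hy] := H2; first by exists 0; rewrite !npairK Xn.
  by exists y; apply/eval_curry_index.
by rewrite !npairK => /eqP /char_eq1.
Qed.

(** Two jumps, because with X = O this keeps O' strictly below the hyperjump of O. *)
Lemma jump_jump_le_KleeneO X : jump (jump X) <=T KleeneO X.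
Proof.
have [|r cr Hr] := @KleeneO_complete (fun g n =>
    forall Z, is_jump g Z -> exists y, eval Z n n y).
  by rewrite /is_jump; definable.
apply: (turing_le_mreduction cr) => n; rewrite -[KleeneO X _]Hr.
split=> [[y Hy] Z /is_jumpP ->|]; first by exists y.
by apply; apply/is_jumpP.
Qed.

Lemma Vstar_le_jump B : ~ omega1_gt_CK B -> Vstar B <=T jump B.
Proof.
move=> ngt; apply/turing_leP.
apply: (@computable_ext _ (fun g m => if odd m then 0 else g m./2)); last by comp.
move=> g m ->; rewrite /char /Vstar /=; case: ifP => _ //.
by case: asboolP => // -[].
Qed.

Lemma KleeneO_le_Vstar B : omega1_gt_CK B -> KleeneO B <=T Vstar B.
Proof.
move=> gt; apply: (@turing_le_mreduction _ _ (fun n => n.*2.+1)); first by comp.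
move=> n; rewrite /Vstar /= odd_double /= uphalf_double.
by split=> [O|[]].
Qed.

Theorem corollary2p4 :
  (forall e_star : nat, (forall X : real, Pi11 e_star X = Vstar X) ->
     forall A : real,
       KleeneO set0 <=T A -> A <T KleeneO (KleeneO set0) ->
       ~ exists B : real, A =T HJ e_star B)
  /\ ~ (forall (e : nat) (A : real), KleeneO set0 <=T A ->
          exists B : real,
            A =T HJ e B /\ HJ e B =T tjoin B (KleeneO set0))
  /\ ~ (forall (e : nat) (A : real), KleeneO set0 <T A ->
          exists B : real,
            A =T HJ e B /\ HJ e B =T tjoin B (KleeneO set0)).
Proof.
have part1 e_star : (forall X : real, Pi11 e_star X = Vstar X) ->
     forall A : real,
       KleeneO set0 <=T A -> A <T KleeneO (KleeneO set0) ->
       ~ exists B : real, A =T HJ e_star B.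
  move=> He A OA [_ nA] [B [AH HA]]; rewrite /HJ He in AH HA.
  have [gt|ngt] := pselect (omega1_gt_CK B).
    apply: nA; apply: turing_le_trans (KleeneO_KleeneO_le gt) _.
    apply: turing_le_trans (KleeneO_le_Vstar gt) _.
    exact: turing_le_trans (tjoin_r _ _) HA.
  apply: (ngt); apply: KleeneO_le_jump_omega1.
  apply: turing_le_trans OA (turing_le_trans AH _).
  by apply: tjoin_computable; [apply: le_jump|apply: Vstar_le_jump].
pose O := KleeneO set0.
have OA : O <T jump O by split; [exact: le_jump|exact: jump_not_le].
have AO : jump O <T KleeneO O.
  split; first exact: turing_le_trans (le_jump _) (jump_jump_le_KleeneO _).
  by move=> le; apply: (@jump_not_le (jump O));
    apply: turing_le_trans (jump_jump_le_KleeneO _) le.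
have [e He] := Vstar_index.
have none := part1 e He (jump O) OA.1 AO.
split=> //; split=> [H|H]; apply: none.
  by have [B [HB _]] := H e (jump O) OA.1; exists B.
by have [B [HB _]] := H e (jump O) OA; exists B.
Qed.
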